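(* Let $q\in(0,1)$ and $m,n\in\mathbb N$. The inner product $(\cdot,\cdot)$ in $\mathbb C[\mathrm{Mat}_{m,n}]_q$ obtained from the $\mathcal P(m,n)_q$-module $H$ coincides with $(\cdot,\cdot)_F$; that is, $$\Big(\frac{\partial P}{\partial z_a^\alpha},Q\Big)=(P,\,Q\cdot z_a^\alpha)$$ for all $P,Q\in\mathbb C[\mathrm{Mat}_{m,n}]_q$ and all $a=1,\dots,n$, $\alpha=1,\dots,m$.
   Context: Ground field $\mathbb C$, $q\in(0,1)$. An inner product is a positive definite Hermitian form, linear in the first argument. $\mathbb C[\mathrm{Mat}_{m,n}]_q$ is the unital algebra with generators $z_a^\alpha$, $a=1,\dots,n$, $\alpha=1,\dots,m$, and relations (R1): $z_a^\alpha z_b^\beta=q z_b^\beta z_a^\alpha$ if ($a=b$, $\alpha<\beta$) or ($a<b$, $\alpha=\beta$); $z_a^\alpha z_b^\beta=z_b^\beta z_a^\alpha$ if $a<b$, $\alpha>\beta$; $z_a^\alpha z_b^\beta=z_b^\beta z_a^\alpha+(q-q^{-1})z_a^\beta z_b^\alpha$ if $a<b$, $\alpha<\beta$. *$q$-partial derivatives.* $\Lambda^1(\mathrm{Mat}_{m,n})_q$ is the $\mathbb C[\mathrm{Mat}_{m,n}]_q$-bimodule with generators $dz_a^\alpha$ and relations $z_b^\beta dz_a^\alpha=\sum_{\alpha',\beta'=1}^m\sum_{a',b'=1}^nR_{\beta\alpha}^{\beta'\alpha'}R_{ba}^{b'a'}dz_{a'}^{\alpha'}\cdot z_{b'}^{\beta'}$,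 where $R_{ba}^{b'a'}=q^{-1}$ if $a=b=a'=b'$; $1$ if $a\ne b$, $a=a'$, $b=b'$; $q^{-1}-q$ if $a<b$, $a=b'$, $b=a'$; $0$ otherwise. It is a free left module with generators $dz_a^\alpha$; $d:\mathbb C[\mathrm{Mat}_{m,n}]_q\to\Lambda^1(\mathrm{Mat}_{m,n})_q$ is the linear map with $d(z_a^\alpha)=dz_a^\alpha$ satisfying the Leibniz rule, and $\frac{\partial f}{\partial z_a^\alpha}$ is defined by $df=\sum_{a,\alpha}\frac{\partial f}{\partial z_a^\alpha}dz_a^\alpha$. $(\cdot,\cdot)_F$ denotes the unique inner product in $\mathbb C[\mathrm{Mat}_{m,n}]_q$ such that $(1,1)_F=1$ and $\big(\frac{\partial P}{\partial z_a^\alpha},Q\big)_F=(P,Q\cdot z_a^\alpha)_F$ for all $P,Q,a,\alpha$. *The inner product $(\cdot,\cdot)$.* $\mathcal P(m,n)_q$ is the unital involutive algebra with generators $z_a^\alpha$ satisfying (R1) and $$(z_b^\beta)^*z_a^\alpha=\sum_{a',b'=1}^n\sum_{\alpha',\beta'=1}^m\widehat R_{ba}^{b'a'}\widehat R_{\beta\alpha}^{\beta'\alpha'}z_{a'}^{\alpha'}(z_{b'}^{\beta'})^*+\delta_{ab}\delta^{\alpha\beta},$$ where $\widehat R_{ba}^{b'a'}=1$ if $a\ne b$, $b=b'$, $a=a'$; $=q$ if $a=b=a'=b'$; $=q-q^{-1}$ if $a=b$, $a'=b'$, $a'>a$; $=0$ otherwise. It contains $\mathbb C[\mathrm{Mat}_{m,n}]_q$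 as a subalgebra. $H$ is the $\mathcal P(m,n)_q$-module with one generator $e_{vac}$ and relations $(z_a^\alpha)^*e_{vac}=0$ for all $a,\alpha$. The map $f\mapsto fe_{vac}$ is an isomorphism of vector spaces $\mathbb C[\mathrm{Mat}_{m,n}]_q\to H$. There is a unique inner product in $H$ with $(e_{vac},e_{vac})=1$ and $(fe_1,e_2)=(e_1,f^*e_2)$ for all $f\in\mathcal P(m,n)_q$, $e_1,e_2\in H$. Transported to $\mathbb C[\mathrm{Mat}_{m,n}]_q$ via $f\mapsto fe_{vac}$ it is denoted $(\cdot,\cdot)$. *)

(* Defs.v *)
From HB Require Import structures.
From mathcomp Require Import all_boot all_order all_algebra.
From mathcomp Require Import boolp.

Set Implicit Arguments.
Unset Strict Implicit.
Unset Printing Implicit Defensive.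
Import Order.TTheory GRing.Theory Num.Theory.
Local Open Scope ring_scope.
Local Open Scope quotient_scope.

Inductive aterm (K G : Type) : Type :=
| AGen of G
| ACst of K                        (* a scalar multiple of the unit *)
| AAdd of aterm K G & aterm K G
| AMul of aterm K G & aterm K G.
Arguments AGen {K G}.
Arguments ACst {K G}.

HB.instance Definition _ (K G : Type) := gen_eqMixin (aterm K G).
HB.instance Definition _ (K G : Type) := gen_choiceMixin (aterm K G).

Definition asum (K : numClosedFieldType) (G I : Type) (r : seq I) (F : I -> aterm K G) :=
  foldr (fun i => AAdd (F i)) (ACst 0) r.

Fixpoint amap (K G G' : Type) (h : G -> G') (x : aterm K G) : aterm K G' :=
  match x with
  | AGen g => AGen (h g)
  | ACst c => ACst c
  | AAdd x y => AAdd (amap h x) (amap h y)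
  | AMul x y => AMul (amap h x) (amap h y)
  end.

(** The least congruence containing [rel] modulo which terms form a unital
    associative K-algebra. *)
Inductive aeq (K : numClosedFieldType) (G : Type)
    (rel : aterm K G -> aterm K G -> Prop) : aterm K G -> aterm K G -> Prop :=
| aeq_rel x y : rel x y -> aeq rel x y
| aeq_refl x : aeq rel x x
| aeq_sym x y : aeq rel x y -> aeq rel y x
| aeq_trans x y z : aeq rel x y -> aeq rel y z -> aeq rel x z
| aeq_add x x' y y' :
    aeq rel x x' -> aeq rel y y' -> aeq rel (AAdd x y) (AAdd x' y')
| aeq_mul x x' y y' :
    aeq rel x x' -> aeq rel y y' -> aeq rel (AMul x y) (AMul x' y')
| aeq_addA x y z : aeq rel (AAdd x (AAdd y z)) (AAdd (AAdd x y) z)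
| aeq_addC x y : aeq rel (AAdd x y) (AAdd y x)
| aeq_add0 x : aeq rel (AAdd (ACst 0) x) x
| aeq_addN x : aeq rel (AAdd (AMul (ACst (-1)) x) x) (ACst 0)
| aeq_mulA x y z : aeq rel (AMul x (AMul y z)) (AMul (AMul x y) z)
| aeq_mul1 x : aeq rel (AMul (ACst 1) x) x
| aeq_mulDl x y z : aeq rel (AMul (AAdd x y) z) (AAdd (AMul x z) (AMul y z))
| aeq_mulDr x y z : aeq rel (AMul x (AAdd y z)) (AAdd (AMul x y) (AMul x z))
| aeq_cstD c d : aeq rel (ACst (c + d)) (AAdd (ACst c) (ACst d))
| aeq_cstM c d : aeq rel (ACst (c * d)) (AMul (ACst c) (ACst d))
| aeq_cstC c x : aeq rel (AMul (ACst c) x) (AMul x (ACst c)).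

Section PresentedAlgebra.
Variables (K : numClosedFieldType) (G : Type).
Variable rel : aterm K G -> aterm K G -> Prop.

Definition aeqb (x y : aterm K G) : bool := `[< aeq rel x y >].

Lemma aeqb_refl : reflexive aeqb.
Proof. by move=> x; apply/asboolP; exact: aeq_refl. Qed.
Lemma aeqb_sym : symmetric aeqb.
Proof. by move=> x y; apply/asboolP/asboolP; exact: aeq_sym. Qed.
Lemma aeqb_trans : transitive aeqb.
Proof.
by move=> y x z /asboolP xy /asboolP yz; apply/asboolP; exact: aeq_trans yz.
Qed.
Canonical aeqb_equiv := EquivRel aeqb aeqb_refl aeqb_sym aeqb_trans.

Definition palg := {eq_quot aeqb}.
HB.instance Definition _ := Choice.on palg.

Definition acl (x : aterm K G) : palg := \pi_({eq_quot aeqb}) x.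
Definition arepr (x : palg) : aterm K G := repr (x : {eq_quot aeqb}).

Lemma areprK : cancel arepr acl.
Proof. exact: reprK. Qed.
Lemma palgW (P : palg -> Prop) : (forall x, P (acl x)) -> forall x, P x.
Proof. by move=> Pcl x; rewrite -(areprK x). Qed.

Lemma palgP (x y : aterm K G) : acl x = acl y <-> aeq rel x y.
Proof.
split; first by move=> /eqP; rewrite eqmodE => /asboolP.
by move=> xy; apply/eqP; rewrite eqmodE; apply/asboolP.
Qed.

Lemma repr_aeq (x : aterm K G) : aeq rel (arepr (acl x)) x.
Proof. by apply/palgP; rewrite areprK. Qed.

Definition pgen (g : G) : palg := acl (AGen g).
Definition pcst (c : K) : palg := acl (ACst c).
Definition padd (x y : palg) : palg := acl (AAdd (arepr x) (arepr y)).
Definition pmul (x y : palg) : palg := acl (AMul (arepr x) (arepr y)).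
Definition popp (x : palg) : palg := pmul (pcst (-1)) x.

Lemma paddE x y : padd (acl x) (acl y) = acl (AAdd x y).
Proof. by apply/palgP; apply: aeq_add; exact: repr_aeq. Qed.
Lemma pmulE x y : pmul (acl x) (acl y) = acl (AMul x y).
Proof. by apply/palgP; apply: aeq_mul; exact: repr_aeq. Qed.

Lemma paddA : associative padd.
Proof.
elim/palgW=> x; elim/palgW=> y; elim/palgW=> z.
by rewrite (paddE y z) (paddE x y) !paddE; apply/palgP; exact: aeq_addA.
Qed.
Lemma paddC : commutative padd.
Proof.
elim/palgW=> x; elim/palgW=> y.
by rewrite !paddE; apply/palgP; exact: aeq_addC.
Qed.
Lemma padd0 : left_id (pcst 0) padd.
Proof. by elim/palgW=> x; rewrite paddE; apply/palgP; exact: aeq_add0. Qed.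
Lemma paddN : left_inverse (pcst 0) popp padd.
Proof.
elim/palgW=> x; by rewrite /popp (pmulE (ACst (-1)) x) paddE; apply/palgP; exact: aeq_addN.
Qed.
Lemma pmulA : associative pmul.
Proof.
elim/palgW=> x; elim/palgW=> y; elim/palgW=> z.
by rewrite (pmulE y z) (pmulE x y) !pmulE; apply/palgP; exact: aeq_mulA.
Qed.
Lemma pmul1 : left_id (pcst 1) pmul.
Proof. by elim/palgW=> x; rewrite pmulE; apply/palgP; exact: aeq_mul1. Qed.
Lemma pcstC c x : pmul (pcst c) x = pmul x (pcst c).
Proof.
by elim/palgW: x => x; rewrite !pmulE; apply/palgP; exact: aeq_cstC.
Qed.
Lemma pmulr1 : right_id (pcst 1) pmul.
Proof. by move=> x; rewrite -pcstC pmul1. Qed.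
Lemma pmulDl : left_distributive pmul padd.
Proof.
elim/palgW=> x; elim/palgW=> y; elim/palgW=> z.
rewrite (paddE x y) (pmulE x z) (pmulE y z) pmulE paddE.
by apply/palgP; exact: aeq_mulDl.
Qed.
Lemma pmulDr : right_distributive pmul padd.
Proof.
elim/palgW=> x; elim/palgW=> y; elim/palgW=> z.
rewrite (paddE y z) (pmulE x y) (pmulE x z) pmulE paddE.
by apply/palgP; exact: aeq_mulDr.
Qed.

HB.instance Definition _ := GRing.isZmodule.Build palg paddA paddC padd0 paddN.
HB.instance Definition _ :=
  GRing.Zmodule_isPzRing.Build palg pmulA pmul1 pmulr1 pmulDl pmulDr.

Definition pscale (c : K) (x : palg) : palg := pcst c * x.
Lemma pcstM c d : pcst (c * d) = pcst c * pcst d.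
Proof. by rewrite [RHS]pmulE; apply/palgP; exact: aeq_cstM. Qed.
Lemma pcstD c d : pcst (c + d) = pcst c + pcst d.
Proof. by rewrite [RHS]paddE; apply/palgP; exact: aeq_cstD. Qed.
Lemma pscaleA c d x : pscale c (pscale d x) = pscale (c * d) x.
Proof. by rewrite /pscale mulrA pcstM. Qed.
Lemma pscale1 : left_id 1 pscale.
Proof. exact: mul1r. Qed.
Lemma pscaleDr : right_distributive pscale +%R.
Proof. by move=> c x y; exact: mulrDr. Qed.
Lemma pscaleDl x : {morph pscale^~ x : c d / c + d}.
Proof. by move=> c d; rewrite /pscale pcstD mulrDl. Qed.
HB.instance Definition _ :=
  GRing.Zmodule_isLmodule.Build K palg pscaleA pscale1 pscaleDr pscaleDl.

(** The library's [algType] is not used because it would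
    additionally require a proof that [1 != 0]. *)
Lemma pscalerAl (c : K) (x y : palg) : c *: (x * y) = (c *: x) * y.
Proof. exact: mulrA. Qed.
Lemma pscalerAr (c : K) (x y : palg) : c *: (x * y) = x * (c *: y).
Proof. by rewrite pscalerAl [c *: x]pcstC -[LHS]mulrA. Qed.

Lemma acl_gen g : acl (AGen g) = pgen g. Proof. by []. Qed.
Lemma acl_cst c : acl (ACst c) = c *: (1 : palg).
Proof. by rewrite [RHS]mulr1. Qed.
Lemma acl_add x y : acl (AAdd x y) = acl x + acl y.
Proof. by rewrite [RHS]paddE. Qed.
Lemma acl_mul x y : acl (AMul x y) = acl x * acl y.
Proof. by rewrite [RHS]pmulE. Qed.
Lemma acl_scale (c : K) (x : aterm K G) :
  c *: acl x = acl (AMul (ACst c) x).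
Proof. by rewrite acl_mul. Qed.
Lemma acl_sum (I : Type) (r : seq I) (F : I -> aterm K G) :
  acl (asum r F) = \sum_(i <- r) acl (F i).
Proof.
elim: r => [|i r IHr] /=; first by rewrite big_nil acl_cst scale0r.
by rewrite acl_add IHr big_cons.
Qed.

End PresentedAlgebra.

(** In an involutive presentation the generator [(false, g)] is [g] and [(true, g)] is its
    adjoint; the relations are closed under the involution. *)

Fixpoint astar (K : numClosedFieldType) (G : Type) (x : aterm K (bool * G)) :
    aterm K (bool * G) :=
  match x with
  | AGen g => AGen (~~ g.1, g.2)
  | ACst c => ACst (Num.conj c)
  | AAdd x y => AAdd (astar x) (astar y)
  | AMul x y => AMul (astar y) (astar x)
  end.

Inductive star_closure (K : numClosedFieldType) (G : Type)
    (rel : aterm K (bool * G) -> aterm K (bool * G) -> Prop) :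
    aterm K (bool * G) -> aterm K (bool * G) -> Prop :=
| StarId x y : rel x y -> star_closure rel x y
| StarAdj x y : rel x y -> star_closure rel (astar x) (astar y).

Lemma astarK (K : numClosedFieldType) (G : Type) : involutive (@astar K G).
Proof.
elim=> [[b g]|c|x IHx y IHy|x IHx y IHy] /=; rewrite ?negbK ?conjCK //.
  by rewrite IHx IHy.
by rewrite IHx IHy.
Qed.

Section PresentedStarAlgebra.
Variables (K : numClosedFieldType) (G : Type).
Variable rel : aterm K (bool * G) -> aterm K (bool * G) -> Prop.

Local Notation pstaralg := (palg (star_closure rel)).
Local Notation cl := (acl (star_closure rel)).

Definition pstar (x : pstaralg) : pstaralg := cl (astar (arepr x)).

Lemma astar_aeq x y :
  aeq (star_closure rel) x y -> aeq (star_closure rel) (astar x) (astar y).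
Proof.
elim=> {x y} /=.
- move=> _ _ [x y xy|x y xy]; apply: aeq_rel; first exact: StarAdj.
  by rewrite !astarK; exact: StarId.
- by move=> x; exact: aeq_refl.
- by move=> x y _; exact: aeq_sym.
- by move=> x y z _ xy _; exact: aeq_trans.
- by move=> x x' y y' _ ? _ ?; exact: aeq_add.
- by move=> x x' y y' _ ? _ ?; exact: aeq_mul.
- by move=> x y z; exact: aeq_addA.
- by move=> x y; exact: aeq_addC.
- by move=> x; rewrite conjC0; exact: aeq_add0.
- move=> x; rewrite rmorphN1 conjC0.
  by apply: aeq_trans (aeq_addN _ _); apply: aeq_add (aeq_refl _ _);
    apply: aeq_sym; exact: aeq_cstC.
- by move=> x y z; apply: aeq_sym; exact: aeq_mulA.
- move=> x; rewrite conjC1; apply: aeq_trans (aeq_mul1 _ _).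
  by apply: aeq_sym; exact: aeq_cstC.
- by move=> x y z; exact: aeq_mulDr.
- by move=> x y z; exact: aeq_mulDl.
- by move=> c d; rewrite rmorphD; exact: aeq_cstD.
- by move=> c d; rewrite mulrC rmorphM; exact: aeq_cstM.
- by move=> c x; apply: aeq_sym; exact: aeq_cstC.
Qed.

Lemma acl_star x : cl (astar x) = pstar (cl x).
Proof.
by apply/palgP/astar_aeq/aeq_sym; exact: repr_aeq.
Qed.

Lemma pstarK : involutive pstar.
Proof. by elim/palgW=> x; rewrite -(acl_star x) -acl_star astarK. Qed.
Lemma pstarD x y : pstar (x + y) = pstar x + pstar y.
Proof.
elim/palgW: x => x; elim/palgW: y => y.
by rewrite -acl_add -(acl_star (AAdd x y)) acl_add !acl_star.
Qed.
Lemma pstarM x y : pstar (x * y) = pstar y * pstar x.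
Proof.
elim/palgW: x => x; elim/palgW: y => y.
by rewrite -acl_mul -(acl_star (AMul x y)) acl_mul !acl_star.
Qed.
Lemma pstarZ (c : K) x : pstar (c *: x) = Num.conj c *: pstar x.
Proof.
elim/palgW: x => x.
rewrite -(acl_star x) !acl_scale -acl_star; apply/palgP => /=.
by apply: aeq_sym; exact: aeq_cstC.
Qed.

End PresentedStarAlgebra.

(** Terms for K-vector spaces carrying linear operators indexed by [W]; module
    and bimodule laws are imposed through the relations. *)

Inductive mterm (K W G : Type) : Type :=
| MGen of G
| MZero
| MAdd of mterm K W G & mterm K W G
| MScale of K & mterm K W G
| MAct of W & mterm K W G.
Arguments MGen {K W G}.
Arguments MZero {K W G}.

HB.instance Definition _ (K W G : Type) := gen_eqMixin (mterm K W G).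
HB.instance Definition _ (K W G : Type) := gen_choiceMixin (mterm K W G).

Definition msum (K W G I : Type) (r : seq I) (F : I -> mterm K W G) :=
  foldr (fun i => MAdd (F i)) MZero r.

Inductive meq (K : numClosedFieldType) (W G : Type)
    (rel : mterm K W G -> mterm K W G -> Prop) :
    mterm K W G -> mterm K W G -> Prop :=
| meq_rel x y : rel x y -> meq rel x y
| meq_refl x : meq rel x x
| meq_sym x y : meq rel x y -> meq rel y x
| meq_trans x y z : meq rel x y -> meq rel y z -> meq rel x z
| meq_add x x' y y' :
    meq rel x x' -> meq rel y y' -> meq rel (MAdd x y) (MAdd x' y')
| meq_scale c x x' : meq rel x x' -> meq rel (MScale c x) (MScale c x')
| meq_act w x x' : meq rel x x' -> meq rel (MAct w x) (MAct w x')
| meq_addA x y z : meq rel (MAdd x (MAdd y z)) (MAdd (MAdd x y) z)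
| meq_addC x y : meq rel (MAdd x y) (MAdd y x)
| meq_add0 x : meq rel (MAdd MZero x) x
| meq_addN x : meq rel (MAdd (MScale (-1) x) x) MZero
| meq_scaleA c d x : meq rel (MScale c (MScale d x)) (MScale (c * d) x)
| meq_scale1 x : meq rel (MScale 1 x) x
| meq_scaleDr c x y :
    meq rel (MScale c (MAdd x y)) (MAdd (MScale c x) (MScale c y))
| meq_scaleDl c d x :
    meq rel (MScale (c + d) x) (MAdd (MScale c x) (MScale d x))
| meq_actD w x y : meq rel (MAct w (MAdd x y)) (MAdd (MAct w x) (MAct w y))
| meq_actZ w c x : meq rel (MAct w (MScale c x)) (MScale c (MAct w x)).

Section PresentedModule.
Variables (K : numClosedFieldType) (W G : Type).
Variable rel : mterm K W G -> mterm K W G -> Prop.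

Definition meqb (x y : mterm K W G) : bool := `[< meq rel x y >].

Lemma meqb_refl : reflexive meqb.
Proof. by move=> x; apply/asboolP; exact: meq_refl. Qed.
Lemma meqb_sym : symmetric meqb.
Proof. by move=> x y; apply/asboolP/asboolP; exact: meq_sym. Qed.
Lemma meqb_trans : transitive meqb.
Proof.
by move=> y x z /asboolP xy /asboolP yz; apply/asboolP; exact: meq_trans yz.
Qed.
Canonical meqb_equiv := EquivRel meqb meqb_refl meqb_sym meqb_trans.

Definition pmod := {eq_quot meqb}.
HB.instance Definition _ := Choice.on pmod.

Definition mcl (x : mterm K W G) : pmod := \pi_({eq_quot meqb}) x.
Definition mrepr (x : pmod) : mterm K W G := repr (x : {eq_quot meqb}).

Lemma mreprK : cancel mrepr mcl.
Proof. exact: reprK. Qed.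
Lemma pmodW (P : pmod -> Prop) : (forall x, P (mcl x)) -> forall x, P x.
Proof. by move=> Pcl x; rewrite -(mreprK x). Qed.

Lemma pmodP (x y : mterm K W G) : mcl x = mcl y <-> meq rel x y.
Proof.
split; first by move=> /eqP; rewrite eqmodE => /asboolP.
by move=> xy; apply/eqP; rewrite eqmodE; apply/asboolP.
Qed.

Lemma repr_meq (x : mterm K W G) : meq rel (mrepr (mcl x)) x.
Proof. by apply/pmodP; rewrite mreprK. Qed.

Definition mgen (g : G) : pmod := mcl (MGen g).
Definition mzero : pmod := mcl MZero.
Definition madd (x y : pmod) : pmod := mcl (MAdd (mrepr x) (mrepr y)).
Definition mscale (c : K) (x : pmod) : pmod := mcl (MScale c (mrepr x)).
Definition mopp (x : pmod) : pmod := mscale (-1) x.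
Definition mact (w : W) (x : pmod) : pmod := mcl (MAct w (mrepr x)).

Lemma maddE x y : madd (mcl x) (mcl y) = mcl (MAdd x y).
Proof. by apply/pmodP; apply: meq_add; exact: repr_meq. Qed.
Lemma mscaleE c x : mscale c (mcl x) = mcl (MScale c x).
Proof. by apply/pmodP; apply: meq_scale; exact: repr_meq. Qed.
Lemma mcl_act w x : mcl (MAct w x) = mact w (mcl x).
Proof. by apply/pmodP; apply/meq_sym/meq_act; exact: repr_meq. Qed.

Lemma maddA : associative madd.
Proof.
elim/pmodW=> x; elim/pmodW=> y; elim/pmodW=> z.
by rewrite (maddE y z) (maddE x y) !maddE; apply/pmodP; exact: meq_addA.
Qed.
Lemma maddC : commutative madd.
Proof.
elim/pmodW=> x; elim/pmodW=> y.
by rewrite !maddE; apply/pmodP; exact: meq_addC.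
Qed.
Lemma madd0 : left_id mzero madd.
Proof. by elim/pmodW=> x; rewrite maddE; apply/pmodP; exact: meq_add0. Qed.
Lemma maddN : left_inverse mzero mopp madd.
Proof.
elim/pmodW=> x; rewrite /mopp (mscaleE (-1) x) maddE.
by apply/pmodP; exact: meq_addN.
Qed.
HB.instance Definition _ := GRing.isZmodule.Build pmod maddA maddC madd0 maddN.

Lemma mscaleA c d x : mscale c (mscale d x) = mscale (c * d) x.
Proof.
elim/pmodW: x => x; rewrite (mscaleE d x) !mscaleE.
by apply/pmodP; exact: meq_scaleA.
Qed.
Lemma mscale1 : left_id 1 mscale.
Proof. by elim/pmodW=> x; rewrite mscaleE; apply/pmodP; exact: meq_scale1. Qed.
Lemma mscaleDr : right_distributive mscale +%R.
Proof.
move=> c; elim/pmodW=> x; elim/pmodW=> y.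
rewrite [_ + _](maddE x y) !mscaleE [RHS]maddE.
by apply/pmodP; exact: meq_scaleDr.
Qed.
Lemma mscaleDl x : {morph mscale^~ x : c d / c + d}.
Proof.
move=> c d; elim/pmodW: x => x.
by rewrite !mscaleE [RHS]maddE; apply/pmodP; exact: meq_scaleDl.
Qed.
HB.instance Definition _ :=
  GRing.Zmodule_isLmodule.Build K pmod mscaleA mscale1 mscaleDr mscaleDl.

Lemma mactD w (x y : pmod) : mact w (x + y) = mact w x + mact w y.
Proof.
elim/pmodW: x => x; elim/pmodW: y => y.
rewrite [X in mact w X](maddE x y) -!mcl_act [RHS]maddE.
by apply/pmodP; exact: meq_actD.
Qed.
Lemma mactZ w c (x : pmod) : mact w (c *: x) = c *: mact w x.
Proof.
elim/pmodW: x => x.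
rewrite [X in mact w X](mscaleE c x) -!mcl_act [RHS]mscaleE.
by apply/pmodP; exact: meq_actZ.
Qed.

Lemma mcl_gen g : mcl (MGen g) = mgen g. Proof. by []. Qed.
Lemma mcl_zero : mcl MZero = 0. Proof. by []. Qed.
Lemma mcl_add x y : mcl (MAdd x y) = mcl x + mcl y.
Proof. by rewrite [RHS]maddE. Qed.
Lemma mcl_scale c x : mcl (MScale c x) = c *: mcl x.
Proof. by rewrite [RHS]mscaleE. Qed.
Lemma mcl_sum (I : Type) (r : seq I) (F : I -> mterm K W G) :
  mcl (msum r F) = \sum_(i <- r) mcl (F i).
Proof.
elim: r => [|i r IHr] /=; first by rewrite big_nil.
by rewrite mcl_add IHr big_cons.
Qed.

End PresentedModule.

Section QuantumMatrices.
Variables (K : numClosedFieldType) (q : K) (m n : nat).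

(** [qmat] is C[Mat_{m,n}]_q, [forms] is Lambda^1(Mat_{m,n})_q, [qpol] is
    P(m,n)_q and [fock] is H; z_a^alpha is indexed by [(a, alpha)]. *)
Local Notation G := ('I_n * 'I_m)%type.
Local Notation Z a alpha := (AGen (a, alpha)).

Inductive mat_rel : aterm K G -> aterm K G -> Prop :=
| MatRow (a b : 'I_n) (alpha beta : 'I_m) :
    ((a == b) && (alpha < beta)%N) || ((a < b)%N && (alpha == beta)) ->
    mat_rel (AMul (Z a alpha) (Z b beta))
            (AMul (ACst q) (AMul (Z b beta) (Z a alpha)))
| MatAnti (a b : 'I_n) (alpha beta : 'I_m) :
    (a < b)%N -> (beta < alpha)%N ->
    mat_rel (AMul (Z a alpha) (Z b beta)) (AMul (Z b beta) (Z a alpha))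
| MatDiag (a b : 'I_n) (alpha beta : 'I_m) :
    (a < b)%N -> (alpha < beta)%N ->
    mat_rel (AMul (Z a alpha) (Z b beta))
            (AAdd (AMul (Z b beta) (Z a alpha))
                  (AMul (ACst (q - q^-1)) (AMul (Z a beta) (Z b alpha)))).

Definition qmat := palg mat_rel.
HB.instance Definition _ := GRing.PzRing.on qmat.
HB.instance Definition _ := GRing.Lmodule.on qmat.

Definition zgen (a : 'I_n) (alpha : 'I_m) : qmat := pgen mat_rel (a, alpha).

(** [Rcoef b a b' a'] is the entry R_{ba}^{b'a'}. *)
Definition Rcoef (k : nat) (b a b' a' : 'I_k) : K :=
  if [&& a == b, b == a' & a' == b'] then q^-1
  else if [&& a != b, a == a' & b == b'] then 1
  else if [&& (a < b)%N, a == b' & b == a'] then q^-1 - q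
  else 0.

(** The operator [inl f] is the left action of [f], [inr f] the right one. *)
Inductive forms_rel :
    mterm K (qmat + qmat) G -> mterm K (qmat + qmat) G -> Prop :=
| FormsL1 x : forms_rel (MAct (inl 1) x) x
| FormsLM f g x :
    forms_rel (MAct (inl (f * g)) x) (MAct (inl f) (MAct (inl g) x))
| FormsLD f g x :
    forms_rel (MAct (inl (f + g)) x) (MAdd (MAct (inl f) x) (MAct (inl g) x))
| FormsLZ c f x :
    forms_rel (MAct (inl (c *: f)) x) (MScale c (MAct (inl f) x))
| FormsR1 x : forms_rel (MAct (inr 1) x) x
| FormsRM f g x :
    forms_rel (MAct (inr (f * g)) x) (MAct (inr g) (MAct (inr f) x))
| FormsRD f g x :
    forms_rel (MAct (inr (f + g)) x) (MAdd (MAct (inr f) x) (MAct (inr g) x))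
| FormsRZ c f x :
    forms_rel (MAct (inr (c *: f)) x) (MScale c (MAct (inr f) x))
| FormsLR f g x :
    forms_rel (MAct (inl f) (MAct (inr g) x)) (MAct (inr g) (MAct (inl f) x))
| FormsZ (a b : 'I_n) (alpha beta : 'I_m) :
    forms_rel
      (MAct (inl (zgen b beta)) (MGen (a, alpha)))
      (msum (enum 'I_m) (fun alpha' => msum (enum 'I_m) (fun beta' =>
       msum (enum 'I_n) (fun a' => msum (enum 'I_n) (fun b' =>
         MScale (Rcoef beta alpha beta' alpha' * Rcoef b a b' a')
                (MAct (inr (zgen b' beta')) (MGen (a', alpha')))))))).

Definition forms := pmod forms_rel.
HB.instance Definition _ := GRing.Lmodule.on forms.

Definition dz (a : 'I_n) (alpha : 'I_m) : forms := mgen forms_rel (a, alpha).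
Definition lact (f : qmat) (w : forms) : forms := mact (inl f : qmat + qmat) w.
Definition ract (w : forms) (f : qmat) : forms := mact (inr f : qmat + qmat) w.

Definition is_differential (d : {linear qmat -> forms}) : Prop :=
  (forall a alpha, d (zgen a alpha) = dz a alpha) /\
  (forall f g, d (f * g) = ract (d f) g + lact f (d g)).

Definition is_partial (d : {linear qmat -> forms})
    (partial : 'I_n -> 'I_m -> qmat -> qmat) : Prop :=
  forall f, d f = \sum_(a < n) \sum_(alpha < m)
                    lact (partial a alpha f) (dz a alpha).

(** The inner products (.,.)_F; [{dot _ for Num.conj}] is linear in its first
    argument. *)
Definition is_F_product (partial : 'I_n -> 'I_m -> qmat -> qmat)
    (form : {dot qmat for Num.conj}) : Prop :=
  form 1 1 = 1 /\
  (forall P Q a alpha,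
     form (partial a alpha P) Q = form P (Q * zgen a alpha)).

(** [Rhat b a b' a'] is the entry \hat R_{ba}^{b'a'}. *)
Definition Rhat (k : nat) (b a b' a' : 'I_k) : K :=
  if [&& a != b, b == b' & a == a'] then 1
  else if [&& a == b, b == a' & a' == b'] then q
  else if [&& a == b, a' == b' & (a < a')%N] then q - q^-1
  else 0.

Local Notation Zp a alpha := (AGen (false, (a, alpha))).
Local Notation Zs a alpha := (AGen (true, (a, alpha))).

Inductive pol_rel : aterm K (bool * G) -> aterm K (bool * G) -> Prop :=
| PolMat x y : mat_rel x y -> pol_rel (amap (pair false) x) (amap (pair false) y)
| PolCross (a b : 'I_n) (alpha beta : 'I_m) :
    pol_rel
      (AMul (Zs b beta) (Zp a alpha))
      (AAdd
        (asum (enum 'I_n) (fun a' => asum (enum 'I_n) (fun b' =>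
         asum (enum 'I_m) (fun alpha' => asum (enum 'I_m) (fun beta' =>
           AMul (ACst (Rhat b a b' a' * Rhat beta alpha beta' alpha'))
                (AMul (Zp a' alpha') (Zs b' beta')))))))
        (ACst ((a == b)%:R * (alpha == beta)%:R))).

Definition qpol := palg (star_closure pol_rel).
HB.instance Definition _ := GRing.PzRing.on qpol.
HB.instance Definition _ := GRing.Lmodule.on qpol.

Definition star (f : qpol) : qpol := pstar f.

(** The canonical homomorphism C[Mat_{m,n}]_q -> P(m,n)_q. *)
Definition qmat_pol (f : qmat) : qpol := 
  acl (star_closure pol_rel) (amap (pair false) (arepr f)).

Inductive fock_rel : mterm K qpol unit -> mterm K qpol unit -> Prop :=
| Fock1 x : fock_rel (MAct 1 x) x
| FockM f g x : fock_rel (MAct (f * g) x) (MAct f (MAct g x))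
| FockD f g x : fock_rel (MAct (f + g) x) (MAdd (MAct f x) (MAct g x))
| FockZ c f x : fock_rel (MAct (c *: f) x) (MScale c (MAct f x))
| FockVac a alpha :
    fock_rel (MAct (star (qmat_pol (zgen a alpha))) (MGen tt)) MZero.

Definition fock := pmod fock_rel.
HB.instance Definition _ := GRing.Lmodule.on fock.

Definition vac : fock := mgen fock_rel tt.
Definition act (f : qpol) (v : fock) : fock := mact f v.

Definition is_fock_product (form : {dot fock for Num.conj}) : Prop :=
  form vac vac = 1 /\
  (forall f e1 e2, form (act f e1) e2 = form e1 (act (star f) e2)).

(** The form on H pulled back along f |-> f e_vac. *)
Definition transport (form : fock -> fock -> K) (P Q : qmat) : K :=
  form (act (qmat_pol P) vac) (act (qmat_pol Q) vac).

Lemma zgen_row (a b : 'I_n) (alpha beta : 'I_m) :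
  ((a == b) && (alpha < beta)%N) || ((a < b)%N && (alpha == beta)) ->
  zgen a alpha * zgen b beta = q *: (zgen b beta * zgen a alpha).
Proof.
move=> h; rewrite -[LHS]acl_mul -[zgen b beta * _]acl_mul acl_scale.
by apply/palgP/aeq_rel/MatRow.
Qed.

Lemma zgen_anti (a b : 'I_n) (alpha beta : 'I_m) :
  (a < b)%N -> (beta < alpha)%N ->
  zgen a alpha * zgen b beta = zgen b beta * zgen a alpha.
Proof.
move=> ab ba; rewrite -[LHS]acl_mul -[RHS]acl_mul.
by apply/palgP/aeq_rel/MatAnti.
Qed.

Lemma zgen_diag (a b : 'I_n) (alpha beta : 'I_m) :
  (a < b)%N -> (alpha < beta)%N ->
  zgen a alpha * zgen b beta =
  zgen b beta * zgen a alpha + (q - q^-1) *: (zgen a beta * zgen b alpha).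
Proof.
move=> ab ba; rewrite -[LHS]acl_mul -[zgen b beta * _]acl_mul.
rewrite -[zgen a beta * _]acl_mul acl_scale -acl_add.
by apply/palgP/aeq_rel/MatDiag.
Qed.

Lemma amap_aeq (x y : aterm K G) : aeq mat_rel x y ->
  aeq (star_closure pol_rel) (amap (pair false) x) (amap (pair false) y).
Proof.
elim=> {x y} /=; try by intros; constructor.
- by move=> x y xy; apply/aeq_rel/StarId/PolMat.
- by move=> x y z _ xy _; exact: aeq_trans.
Qed.

Lemma qmat_pol_acl (x : aterm K G) :
  qmat_pol (acl mat_rel x) = acl (star_closure pol_rel) (amap (pair false) x).
Proof. by apply/palgP/amap_aeq; exact: repr_aeq. Qed.

Lemma qmat_pol1 : qmat_pol 1 = 1.
Proof. exact: (qmat_pol_acl (ACst 1)). Qed.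
Lemma qmat_polD f g : qmat_pol (f + g) = qmat_pol f + qmat_pol g.
Proof.
elim/palgW: f => f; elim/palgW: g => g.
by rewrite -acl_add !qmat_pol_acl -acl_add.
Qed.
Lemma qmat_polM f g : qmat_pol (f * g) = qmat_pol f * qmat_pol g.
Proof.
elim/palgW: f => f; elim/palgW: g => g.
by rewrite -acl_mul !qmat_pol_acl -acl_mul.
Qed.
Lemma qmat_polZ c f : qmat_pol (c *: f) = c *: qmat_pol f.
Proof.
elim/palgW: f => f; rewrite [c *: _]acl_scale !qmat_pol_acl /=.
by rewrite acl_mul.
Qed.

Lemma star_zgen_mul (a b : 'I_n) (alpha beta : 'I_m) :
  star (qmat_pol (zgen b beta)) * qmat_pol (zgen a alpha) =
  \sum_(a' < n) \sum_(b' < n) \sum_(alpha' < m) \sum_(beta' < m)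
    (Rhat b a b' a' * Rhat beta alpha beta' alpha') *:
      (qmat_pol (zgen a' alpha') * star (qmat_pol (zgen b' beta')))
  + ((a == b)%:R * (alpha == beta)%:R : K) *: (1 : qpol).
Proof.
have zE c gamma :
    qmat_pol (zgen c gamma) = acl (star_closure pol_rel) (Zp c gamma).
  exact: qmat_pol_acl.
have sE c gamma :
    star (qmat_pol (zgen c gamma)) = acl (star_closure pol_rel) (Zs c gamma).
  by rewrite zE /star -acl_star.
rewrite sE zE -acl_mul -acl_cst.
transitivity (acl (star_closure pol_rel) (AAdd
    (asum (enum 'I_n) (fun a' => asum (enum 'I_n) (fun b' =>
     asum (enum 'I_m) (fun alpha' => asum (enum 'I_m) (fun beta' =>
       AMul (ACst (Rhat b a b' a' * Rhat beta alpha beta' alpha'))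
            (AMul (Zp a' alpha') (Zs b' beta')))))))
    (ACst ((a == b)%:R * (alpha == beta)%:R)))).
  by apply/palgP/aeq_rel/StarId/PolCross.
rewrite acl_add; congr (_ + _).
rewrite acl_sum big_enum /=; apply: eq_bigr => a' _.
rewrite acl_sum big_enum /=; apply: eq_bigr => b' _.
rewrite acl_sum big_enum /=; apply: eq_bigr => alpha' _.
rewrite acl_sum big_enum /=; apply: eq_bigr => beta' _.
by rewrite zE sE !acl_mul.
Qed.

Lemma lact1 w : lact 1 w = w.
Proof.
elim/pmodW: w => w; rewrite /lact -mcl_act.
by apply/pmodP/meq_rel/FormsL1.
Qed.
Lemma lactM f g w : lact (f * g) w = lact f (lact g w).
Proof.
elim/pmodW: w => w; rewrite /lact -(mcl_act _ (inl g)) -!mcl_act.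
by apply/pmodP/meq_rel/FormsLM.
Qed.
Lemma lactDl f g w : lact (f + g) w = lact f w + lact g w.
Proof.
elim/pmodW: w => w; rewrite /lact -!mcl_act -mcl_add.
by apply/pmodP/meq_rel/FormsLD.
Qed.
Lemma lactZl c f w : lact (c *: f) w = c *: lact f w.
Proof.
elim/pmodW: w => w; rewrite /lact -!mcl_act -mcl_scale.
by apply/pmodP/meq_rel/FormsLZ.
Qed.
Lemma ract1 w : ract w 1 = w.
Proof.
elim/pmodW: w => w; rewrite /ract -mcl_act.
by apply/pmodP/meq_rel/FormsR1.
Qed.
Lemma ractM f g w : ract w (f * g) = ract (ract w f) g.
Proof.
elim/pmodW: w => w; rewrite /ract -(mcl_act _ (inr f)) -!mcl_act.
by apply/pmodP/meq_rel/FormsRM.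
Qed.
Lemma ractDr f g w : ract w (f + g) = ract w f + ract w g.
Proof.
elim/pmodW: w => w; rewrite /ract -!mcl_act -mcl_add.
by apply/pmodP/meq_rel/FormsRD.
Qed.
Lemma ractZr c f w : ract w (c *: f) = c *: ract w f.
Proof.
elim/pmodW: w => w; rewrite /ract -!mcl_act -mcl_scale.
by apply/pmodP/meq_rel/FormsRZ.
Qed.
Lemma lract f g w : lact f (ract w g) = ract (lact f w) g.
Proof.
elim/pmodW: w => w; rewrite /lact /ract.
rewrite -(mcl_act _ (inr g)) -(mcl_act _ (inl f)) -!mcl_act.
by apply/pmodP/meq_rel/FormsLR.
Qed.

Lemma lact_zgen_dz (a b : 'I_n) (alpha beta : 'I_m) :
  lact (zgen b beta) (dz a alpha) =
  \sum_(alpha' < m) \sum_(beta' < m) \sum_(a' < n) \sum_(b' < n)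
    (Rcoef beta alpha beta' alpha' * Rcoef b a b' a') *:
      ract (dz a' alpha') (zgen b' beta').
Proof.
rewrite /lact -mcl_act.
transitivity (mcl forms_rel
  (msum (enum 'I_m) (fun alpha' => msum (enum 'I_m) (fun beta' =>
   msum (enum 'I_n) (fun a' => msum (enum 'I_n) (fun b' =>
     MScale (Rcoef beta alpha beta' alpha' * Rcoef b a b' a')
            (MAct (inr (zgen b' beta')) (MGen (a', alpha'))))))))).
  by apply/pmodP/meq_rel/FormsZ.
rewrite mcl_sum big_enum /=; apply: eq_bigr => alpha' _.
rewrite mcl_sum big_enum /=; apply: eq_bigr => beta' _.
rewrite mcl_sum big_enum /=; apply: eq_bigr => a' _.
rewrite mcl_sum big_enum /=; apply: eq_bigr => b' _.
by rewrite mcl_scale mcl_act.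
Qed.

Lemma act1 v : act 1 v = v.
Proof.
elim/pmodW: v => v; rewrite /act -mcl_act.
by apply/pmodP/meq_rel/Fock1.
Qed.
Lemma actM f g v : act (f * g) v = act f (act g v).
Proof.
elim/pmodW: v => v; rewrite /act -(mcl_act _ g) -!mcl_act.
by apply/pmodP/meq_rel/FockM.
Qed.
Lemma actDl f g v : act (f + g) v = act f v + act g v.
Proof.
elim/pmodW: v => v; rewrite /act -!mcl_act -mcl_add.
by apply/pmodP/meq_rel/FockD.
Qed.
Lemma actZl c f v : act (c *: f) v = c *: act f v.
Proof.
elim/pmodW: v => v; rewrite /act -!mcl_act -mcl_scale.
by apply/pmodP/meq_rel/FockZ.
Qed.
Lemma act_star_vac a alpha : act (star (qmat_pol (zgen a alpha))) vac = 0.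
Proof. by rewrite /act -mcl_act; apply/pmodP/meq_rel/FockVac. Qed.

End QuantumMatrices.

(* Main.v *)
Require Import Defs.
From mathcomp Require Import all_boot all_order all_algebra.
From mathcomp Require Import complex reals boolp zify ring.
Set Implicit Arguments.
Unset Strict Implicit.
Unset Printing Implicit Defensive.
Import GRing.Theory Num.Theory.
Local Open Scope ring_scope.

(** In the Fock space the adjoint of left multiplication by z_b is the
    annihilation operator z_b^*.  The theorem says that the adjoint of right
    multiplication by z_a is the partial derivative ∂_a.  Left and right
    multiplications commute, so their adjoints should too; conversely, once it is
    known that z_b^* and ∂_a commute, moving the left factors of Q one at a time
    across the form reduces (∂_a P, Q) = (P, Q z_a) to the case Q = 1.  There both
    sides are the coefficient of z_a in P (adjoint_dpart1).

    Commutation (left_derivatives) is an induction on P by left multiplication with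
    generators.  Since d(z_c f) = dz_c f + z_c df, one has
    ∂_a(z_c f) = T_c^a(f) + z_c ∂_a f, where dz_c f is the sum of the T_c^e(f) dz_e.
    The relation of z_b^* with z_c and that of dz_c with z_d are both given by the
    same R-matrix, and compatibility of z_b^* with the operators T is the
    Yang-Baxter equation for it.

    To use this for the given partial derivatives, one needs that they are the
    coordinates of d in the dz_e, i.e. that the 1-forms are free as a left module.
    This is obtained from a model: T extends to a matrix representation of the
    algebra (slide_aeq), because the defining relations amount to
    R Z_1 Z_2 = Z_2 Z_1 R (exchange_relations) and R satisfies the Yang-Baxter
    equation; and the relations of the bimodule hold in the model because its
    coefficients are inverse to R (inv_braidK).

    Finally, the values of a form with the adjointness property are determined by
    (1, 1) = 1, which gives the equality of the two inner products. *)

(** * Contraction with a rank-four array and the Yang-Baxter equation *)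

Lemma exchange_sum3 (V : zmodType) (I : finType) (F : I -> I -> I -> I -> I -> I -> V) :
  \sum_a \sum_b \sum_c \sum_d \sum_e \sum_f F a b c d e f =
  \sum_d \sum_e \sum_f \sum_a \sum_b \sum_c F a b c d e f.
Proof.
have exchange1 (G : I -> I -> I -> I -> V) :
    \sum_a \sum_b \sum_c \sum_d G a b c d = \sum_d \sum_a \sum_b \sum_c G a b c d.
  rewrite [RHS]exchange_big; apply: eq_bigr => a _.
  rewrite [RHS]exchange_big; apply: eq_bigr => b _.
  exact: exchange_big.
rewrite exchange1; apply: eq_bigr => d _.
rewrite exchange1; apply: eq_bigr => e _.
exact: exchange1.
Qed.

Section Contraction.
Variable K : numClosedFieldType.

(** The array [R] is read as an operator on a tensor square, sending the basis
    vector with indices [c], [d] to the sum over [e], [f] of [R c d e f] times the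
    one with indices [e], [f]; [F] gives the values of a linear map on basis
    vectors.  Composing operators becomes nesting contractions, so identities
    between products of arrays are proved by rewriting nested contractions. *)
Definition contract (I : finType) (V : lmodType K) (R : I -> I -> I -> I -> K)
    (F : I -> I -> V) (c d : I) : V :=
  \sum_e \sum_f R c d e f *: F e f.

Lemma eq_contract (I : finType) (V : lmodType K) (R : I -> I -> I -> I -> K)
    (F F' : I -> I -> V) c d :
  (forall e f, F e f = F' e f) -> contract R F c d = contract R F' c d.
Proof. by move=> FF'; apply: eq_bigr => e _; apply: eq_bigr => f _; rewrite FF'. Qed.

(** Operators acting on different tensor factors commute. *)
Lemma contractC (I J : finType) (V : lmodType K) (R : I -> I -> I -> I -> K)
    (S : J -> J -> J -> J -> K) (F : I -> I -> J -> J -> V) c d x y :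
  contract R (fun e f => contract S (F e f) x y) c d =
  contract S (fun g h => contract R (fun e f => F e f g h) c d) x y.
Proof.
transitivity (\sum_e \sum_f \sum_g \sum_h (R c d e f * S x y g h) *: F e f g h).
  apply: eq_bigr => e _; apply: eq_bigr => f _; rewrite scaler_sumr.
  by apply: eq_bigr => g _; rewrite scaler_sumr; apply: eq_bigr => h _; rewrite scalerA.
transitivity (\sum_g \sum_h \sum_e \sum_f (R c d e f * S x y g h) *: F e f g h).
  under eq_bigr => e _ do rewrite exchange_big /=.
  rewrite exchange_big /=; apply: eq_bigr => g _.
  under eq_bigr => e _ do rewrite exchange_big /=.
  by rewrite exchange_big.
apply: eq_bigr => g _; apply: eq_bigr => h _; rewrite scaler_sumr.
apply: eq_bigr => e _; rewrite scaler_sumr; apply: eq_bigr => f _.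
by rewrite scalerA mulrC.
Qed.

Lemma contract_sum (I J : finType) (V : lmodType K) (S : I -> I -> I -> I -> K)
    (H : J -> I -> I -> V) x y :
  contract S (fun e f => \sum_j H j e f) x y = \sum_j contract S (H j) x y.
Proof.
rewrite exchange_big; apply: eq_bigr => e _.
by rewrite exchange_big; apply: eq_bigr => f _; rewrite scaler_sumr.
Qed.

(** The identity R_12 R_13 R_23 = R_23 R_13 R_12, entry by entry. *)
Definition yang_baxter (I : finType) (R : I -> I -> I -> I -> K) : Prop :=
  forall c d x c2 d2 x2,
  \sum_c1 \sum_d1 \sum_x1 R c d c1 d1 * R c1 x c2 x1 * R d1 x1 d2 x2 =
  \sum_d1 \sum_x1 \sum_c1 R d x d1 x1 * R c x1 c1 x2 * R c1 d1 c2 d2.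

Lemma contract_expandl (I : finType) (V : lmodType K)
    (R : I -> I -> I -> I -> K) (F : I -> I -> I -> V) c d x :
    contract R (fun c1 d1 => contract R (fun c2 x1 =>
      contract R (fun d2 x2 => F c2 d2 x2) d1 x1) c1 x) c d =
    \sum_c2 \sum_d2 \sum_x2
      (\sum_c1 \sum_d1 \sum_x1 R c d c1 d1 * R c1 x c2 x1 * R d1 x1 d2 x2)
        *: F c2 d2 x2.
Proof.
transitivity (\sum_c1 \sum_d1 \sum_x1 \sum_c2 \sum_d2 \sum_x2
    (R c d c1 d1 * R c1 x c2 x1 * R d1 x1 d2 x2) *: F c2 d2 x2).
  apply: eq_bigr => c1 _; apply: eq_bigr => d1 _.
  rewrite exchange_big scaler_sumr; apply: eq_bigr => c2 _.
  rewrite scaler_sumr; apply: eq_bigr => x1 _; rewrite scalerA scaler_sumr.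
  apply: eq_bigr => d2 _; rewrite scaler_sumr.
  by apply: eq_bigr => x2 _; rewrite scalerA.
rewrite exchange_sum3; do 3 (apply: eq_bigr => ? _).
by do 3 (rewrite scaler_suml; apply: eq_bigr => ? _).
Qed.

Lemma contract_expandr (I : finType) (V : lmodType K)
    (R : I -> I -> I -> I -> K) (F : I -> I -> I -> V) c d x :
    contract R (fun d1 x1 => contract R (fun c1 x2 =>
      contract R (fun c2 d2 => F c2 d2 x2) c1 d1) c x1) d x =
    \sum_c2 \sum_d2 \sum_x2
      (\sum_d1 \sum_x1 \sum_c1 R d x d1 x1 * R c x1 c1 x2 * R c1 d1 c2 d2)
        *: F c2 d2 x2.
Proof.
transitivity (\sum_d1 \sum_x1 \sum_c1 \sum_c2 \sum_d2 \sum_x2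
    (R d x d1 x1 * R c x1 c1 x2 * R c1 d1 c2 d2) *: F c2 d2 x2).
  apply: eq_bigr => d1 _; apply: eq_bigr => x1 _.
  rewrite scaler_sumr; apply: eq_bigr => c1 _.
  transitivity (\sum_x2 \sum_c2 \sum_d2
    (R d x d1 x1 * R c x1 c1 x2 * R c1 d1 c2 d2) *: F c2 d2 x2).
    rewrite scaler_sumr; apply: eq_bigr => x2 _; rewrite scalerA scaler_sumr.
    apply: eq_bigr => c2 _; rewrite scaler_sumr.
    by apply: eq_bigr => d2 _; rewrite scalerA.
  by rewrite exchange_big; apply: eq_bigr => c2 _; rewrite exchange_big.
rewrite exchange_sum3; do 3 (apply: eq_bigr => ? _).
by do 3 (rewrite scaler_suml; apply: eq_bigr => ? _).
Qed.

Lemma contract_yang_baxter (I : finType) (R : I -> I -> I -> I -> K) :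
  yang_baxter R ->
  forall (V : lmodType K) (F : I -> I -> I -> V) c d x,
  contract R (fun c1 d1 => contract R (fun c2 x1 =>
    contract R (fun d2 x2 => F c2 d2 x2) d1 x1) c1 x) c d =
  contract R (fun d1 x1 => contract R (fun c1 x2 =>
    contract R (fun c2 d2 => F c2 d2 x2) c1 d1) c x1) d x.
Proof.
move=> YR V F c d x; rewrite contract_expandl contract_expandr.
apply: eq_bigr => c2 _; apply: eq_bigr => d2 _.
by apply: eq_bigr => x2 _; rewrite YR.
Qed.

(** Evaluating at the indicator of a triple of indices recovers the entries of the
    two sides. *)
Lemma yang_baxter_scalar (I : finType) (R : I -> I -> I -> I -> K) :
  (forall (F : I -> I -> I -> K^o) c d x,
  contract R (fun c1 d1 => contract R (fun c2 x1 =>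
    contract R (fun d2 x2 => F c2 d2 x2) d1 x1) c1 x) c d =
  contract R (fun d1 x1 => contract R (fun c1 x2 =>
    contract R (fun c2 d2 => F c2 d2 x2) c1 d1) c x1) d x) ->
  yang_baxter R.
Proof.
move=> YR c d x c2 d2 x2.
have := YR (fun e f g => (e == c2)%:R * (f == d2)%:R * (g == x2)%:R) c d x.
rewrite contract_expandl contract_expandr.
have sum_delta (C : I -> I -> I -> K) : \sum_e \sum_f \sum_g
    C e f g *: (((e == c2)%:R * (f == d2)%:R * (g == x2)%:R : K) : K^o) = C c2 d2 x2.
  rewrite (bigD1 c2) //= (bigD1 d2) //= (bigD1 x2) //= !eqxx !mulr1 [_ *: _]mulr1.
  rewrite !big1 ?addr0 // => [e /negPf ne|f /negPf nf|g /negPf ng].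
  - by do 2 (apply: big1 => ? _); rewrite ne !mul0r scaler0.
  - by apply: big1 => ? _; rewrite nf mulr0 mul0r scaler0.
  - by rewrite ng mulr0 scaler0.
by rewrite !sum_delta.
Qed.

(** In this form of the equation one index, [x], is contracted the other way
    round, as happens when an annihilation operator is moved through a braiding:
    the array that reorders annihilation and creation operators is a partial
    transpose of the braiding. *)
Lemma yang_baxter_sum (I : finType) (R : I -> I -> I -> I -> K) (V : lmodType K)
    (X : I -> I -> I -> V) c d b :
  yang_baxter R ->
  \sum_e \sum_f R c d e f *: (\sum_g \sum_h R f h g b *:
    (\sum_i \sum_x R e x i h *: X i g x)) =
  \sum_e \sum_y R c y e b *: (\sum_f \sum_x R d x f y *:
    (\sum_i \sum_g R e f i g *: X i g x)).
Proof.
move=> YR.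
transitivity (\sum_i \sum_g \sum_x
    (\sum_e \sum_f \sum_h R c d e f * R e x i h * R f h g b) *: X i g x).
  transitivity (\sum_e \sum_f \sum_h \sum_i \sum_g \sum_x
      (R c d e f * R e x i h * R f h g b) *: X i g x).
    apply: eq_bigr => e _; apply: eq_bigr => f _.
    rewrite exchange_big scaler_sumr; apply: eq_bigr => h _ /=.
    rewrite [RHS]exchange_big scaler_sumr; apply: eq_bigr => g _.
    rewrite scalerA scaler_sumr; apply: eq_bigr => i _; rewrite scaler_sumr.
    by apply: eq_bigr => x _; rewrite scalerA mulrAC.
  rewrite exchange_sum3; do 3 (apply: eq_bigr => ? _).
  by do 3 (rewrite scaler_suml; apply: eq_bigr => ? _).
transitivity (\sum_i \sum_g \sum_x
    (\sum_f \sum_y \sum_e R d x f y * R c y e b * R e f i g) *: X i g x).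
  apply: eq_bigr => i _; apply: eq_bigr => g _; apply: eq_bigr => x _.
  by rewrite YR.
transitivity (\sum_f \sum_y \sum_e \sum_i \sum_g \sum_x
    (R d x f y * R c y e b * R e f i g) *: X i g x).
  rewrite exchange_sum3; do 3 (apply: eq_bigr => ? _).
  by do 3 (rewrite scaler_suml; apply: eq_bigr => ? _).
transitivity (\sum_e \sum_y \sum_f \sum_i \sum_g \sum_x
    (R d x f y * R c y e b * R e f i g) *: X i g x).
  under eq_bigr => f _ do rewrite exchange_big.
  rewrite exchange_big; apply: eq_bigr => e _; exact: exchange_big.
apply: eq_bigr => e _; apply: eq_bigr => y _.
rewrite scaler_sumr; apply: eq_bigr => f _.
transitivity (\sum_x \sum_i \sum_g (R d x f y * R c y e b * R e f i g) *: X i g x).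
  by rewrite [RHS]exchange_big; apply: eq_bigr => i _; rewrite [RHS]exchange_big.
rewrite scaler_sumr; apply: eq_bigr => x _; rewrite scalerA scaler_sumr.
apply: eq_bigr => i _; rewrite scaler_sumr; apply: eq_bigr => g _.
by rewrite scalerA [R c y e b * _]mulrC.
Qed.

Definition tensor (I J : finType) (R : I -> I -> I -> I -> K)
    (S : J -> J -> J -> J -> K) (c d e f : I * J) : K :=
  R c.1 d.1 e.1 f.1 * S c.2 d.2 e.2 f.2.

Lemma contract_tensor (I J : finType) (R : I -> I -> I -> I -> K)
    (S : J -> J -> J -> J -> K) (V : lmodType K) (F : I * J -> I * J -> V) c d :
  contract (tensor R S) F c d =
  contract R (fun e f => contract S (fun g h => F (e, g) (f, h)) c.2 d.2) c.1 d.1.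
Proof.
pose H e g f h := tensor R S c d (e, g) (f, h) *: F (e, g) (f, h).
transitivity (\sum_e \sum_g \sum_f \sum_h H e g f h).
  rewrite pair_bigA; apply: eq_bigr => -[e g] _.
  by rewrite pair_bigA; apply: eq_bigr => -[f h] _.
apply: eq_bigr => e _; rewrite exchange_big /=; apply: eq_bigr => f _.
rewrite scaler_sumr; apply: eq_bigr => g _; rewrite scaler_sumr.
apply: eq_bigr => h _; by rewrite scalerA.
Qed.

(** The factors acting on [I] and on [J] commute, so the two equations can be
    applied one after the other. *)
Lemma tensor_yang_baxter (I J : finType) (R : I -> I -> I -> I -> K)
    (S : J -> J -> J -> J -> K) :
  yang_baxter R -> yang_baxter S -> yang_baxter (tensor R S).
Proof.
move=> /contract_yang_baxter YR /contract_yang_baxter YS.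
apply: yang_baxter_scalar => F [c c'] [d d'] [x x'].
rewrite !contract_tensor /=.
pose G c2 d2 x2 := contract S (fun c1' d1' => contract S (fun c2' x1' =>
  contract S (fun d2' x2' => F (c2, c2') (d2, d2') (x2, x2')) d1' x1') c1' x') c' d'.
transitivity (contract R (fun c1 d1 => contract R (fun c2 x1 =>
    contract R (fun d2 x2 => G c2 d2 x2) d1 x1) c1 x) c d).
  apply: eq_contract => c1 d1.
  under eq_contract => c1' d1' do (rewrite contract_tensor /=;
    under eq_contract => c2 x1 do (under eq_contract => c2' x1' do
      rewrite contract_tensor /=; rewrite -(contractC R S))).
  rewrite -(contractC R S); apply: eq_contract => c2 x1.
  by rewrite -(contractC R S).
rewrite (YR _ G).
symmetry; apply: eq_contract => d1 x1.
under eq_contract => d1' x1' do (rewrite contract_tensor /=;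
    under eq_contract => c1 x2 do (under eq_contract => c1' x2' do
      rewrite contract_tensor /=; rewrite -(contractC R S))).
rewrite -(contractC R S); apply: eq_contract => c1 x2.
rewrite -(contractC R S); apply: eq_contract => c2 d2.
by rewrite /G YS.
Qed.

Variable q : K.

(** * The R-matrix of type A *)

(** The partial transpose of the coefficients \hat R.  It is the R-matrix of
    U_q(gl_k), and it is inverse to the coefficients R of the bimodule of
    1-forms; hence it governs all three families of relations. *)
Definition braid (k : nat) (c d e f : 'I_k) : K := Rhat q f c d e.

Lemma contract_swap (I : finType) (V : lmodType K) (R : I -> I -> I -> I -> K)
    (F : I -> I -> V) c d (x y : K) :
  (forall e f, R c d e f =
     x * ((e == c) && (f == d))%:R + y * ((e == d) && (f == c))%:R) ->
  contract R F c d = x *: F c d + y *: F d c.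
Proof.
move=> RE.
have sum_delta (i j : I) (a : K) :
    \sum_e \sum_f (a * ((e == i) && (f == j))%:R) *: F e f = a *: F i j.
  rewrite (bigD1 i) //= (bigD1 j) //= !eqxx mulr1.
  rewrite !big1 ?addr0 // => [e /negPf ne|f /negPf nf].
    by apply: big1 => f _; rewrite ne mulr0 scale0r.
  by rewrite nf mulr0 scale0r.
rewrite -sum_delta -[X in _ = _ + X]sum_delta -big_split; apply: eq_bigr => e _.
rewrite -big_split; apply: eq_bigr => f _; rewrite /= -scalerDl; congr (_ *: _).
exact: RE.
Qed.

Lemma contract_braid (k : nat) (V : lmodType K) (F : 'I_k -> 'I_k -> V) c d :
  contract (@braid k) F c d =
  (if c == d then q else 1) *: F c d + ((c < d)%N%:R * (q - q^-1)) *: F d c.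
Proof.
apply: contract_swap => e f.
rewrite /braid /Rhat; have [->|ec] := eqVneq e c; have [->|fd] := eqVneq f d;
  have [?|cd] := eqVneq c d; subst; rewrite ?eqxx ?ltnn //=;
  rewrite ?(eq_sym c f) ?(eq_sym d e) ?(negPf ec) ?(negPf fd) ?(negPf cd) /= .
all: rewrite ?andbF ?mulr0 ?mulr1 ?mul0r ?addr0 ?add0r ?mul1r //=.
have [fc|] := eqVneq f c; last by rewrite andbF mulr0.
rewrite fc andbT (eq_sym c e) (negPf ec) /=.
by have [->|] := eqVneq e d; rewrite ?mulr0 // mulr1; case: ltnP; rewrite ?mul1r ?mul0r.
Qed.

(** Each contraction with [braid] has at most two terms, whose coefficients depend
    only on the relative order of the indices, so the equation is a polynomial
    identity in [q] and its inverse for each order type of a triple. *)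
Lemma braid_yang_baxter k : q != 0 -> yang_baxter (@braid k).
Proof.
move=> q0; apply: yang_baxter_scalar => F c d x.
have regularE (a b u v : K) :
  (a *: (u : K^o) + b *: (v : K^o) : K^o) = (a * u + b * v : K) by [].
rewrite !contract_braid -!val_eqE /=.
have [cd|dc|/val_inj ecd] := ltngtP c d; have [dx|xd|/val_inj edx] := ltngtP d x;
  have [cx|xc|/val_inj ecx] := ltngtP c x; try lia; subst; rewrite ?ltnn ?eqxx;
  try lia; rewrite !regularE ?mulr1n ?mulr0n.
all: match goal with |- @eq _ ?L ?R => change (@eq K L R) end.
all: by field.
Qed.

End Contraction.

(** * The exchange relation and the action by matrices *)

Section Exchange.
Variables (K : numClosedFieldType) (q : K) (m n : nat).
Hypothesis q0 : q != 0.

(** The defining relations of the quantum matrix algebra are equivalent to a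
    single relation of the form R Z_1 Z_2 = Z_2 Z_1 R.  The array [Y] stands for
    the products of two generators, so that the equivalence serves both to deduce
    the exchange relation in the algebra and to recognize operators that satisfy
    the defining relations. *)
Lemma exchange_relations (V : lmodType K)
    (Y : 'I_n -> 'I_m -> 'I_n -> 'I_m -> V) :
  (forall (a b : 'I_n) (alpha beta : 'I_m),
     contract (@braid K q n) (fun b' a' => Y a' alpha b' beta) b a =
     contract (@braid K q m) (fun alpha' beta' => Y b beta' a alpha') alpha beta)
  <-> [/\ forall (a b : 'I_n) (alpha beta : 'I_m),
        ((a == b) && (alpha < beta)%N) || ((a < b)%N && (alpha == beta)) ->
        Y a alpha b beta = q *: Y b beta a alpha,
      forall (a b : 'I_n) (alpha beta : 'I_m), (a < b)%N -> (beta < alpha)%N ->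
        Y a alpha b beta = Y b beta a alpha
    & forall (a b : 'I_n) (alpha beta : 'I_m), (a < b)%N -> (alpha < beta)%N ->
        Y a alpha b beta = Y b beta a alpha + (q - q^-1) *: Y a beta b alpha].
Proof.
split=> [Ex | [Row Anti Diag] a b alpha beta].
  have Anti (a b : 'I_n) (alpha beta : 'I_m) : (a < b)%N -> (beta < alpha)%N ->
      Y a alpha b beta = Y b beta a alpha.
    move=> ab ba; have := Ex a b alpha beta.
    rewrite !contract_braid -!val_eqE /= !(gtn_eqF ab) !(gtn_eqF ba).
    by rewrite !ltnNge !(ltnW ab) !(ltnW ba) /= !mul0r !scale0r !scale1r !addr0.
  split=> // [a b alpha beta | a b alpha beta ab lt_ab].
    case/orP=> /andP[].
      move=> /eqP <- lt_ab; have := Ex a a alpha beta.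
      rewrite !contract_braid eqxx ltnn lt_ab -val_eqE /= (ltn_eqF lt_ab).
      rewrite mul0r scale0r addr0 scale1r mul1r => /eqP; rewrite -subr_eq -scalerBl.
      rewrite opprB addrC subrK => /eqP <-; by rewrite scalerA mulfV ?scale1r.
    move=> ab /eqP <-; have := Ex a b alpha alpha.
    rewrite !contract_braid eqxx ltnn -val_eqE /= (gtn_eqF ab) ltnNge (ltnW ab) /=.
    by rewrite !mul0r !scale0r !addr0 scale1r.
  have := Ex a b alpha beta.
  rewrite !contract_braid -!val_eqE /= (gtn_eqF ab) (ltn_eqF lt_ab) lt_ab.
  rewrite ltnNge (ltnW ab) /= mul0r mul1r scale0r addr0 !scale1r => ->.
  by rewrite (Anti a b).
have hecke : 1 + (q - q^-1) * q = q * q by rewrite mulrBl mulVf // addrC subrK.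
rewrite !contract_braid -!val_eqE /=.
have [ab|ba|/val_inj eab] := ltngtP a b;
  have [lt_ab|lt_ba|/val_inj e_ab] := ltngtP alpha beta; subst;
  rewrite ?(mul1r, mul0r, scale1r, scale0r, addr0).
- by rewrite Diag // (Anti a b beta alpha).
- exact: Anti.
- by apply: Row; rewrite ab eqxx orbT.
- by rewrite (Anti b a beta alpha).
- by rewrite (Diag b a beta alpha).
- by rewrite (Row b a beta beta) ?ba ?eqxx ?orbT // !scalerA -hecke scalerDl scale1r.
- by rewrite (Row b b alpha beta) ?eqxx ?lt_ab // !scalerA -hecke scalerDl scale1r.
- by rewrite (Row b b beta alpha) ?eqxx ?lt_ba.
- by [].
Qed.

Local Notation G := ('I_n * 'I_m)%type.
Local Notation A := (qmat q m n).

Definition gen (g : G) : A := zgen q g.1 g.2.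

Definition mbraid : G -> G -> G -> G -> K := tensor (@braid K q n) (@braid K q m).

Lemma mbraid_yang_baxter : yang_baxter mbraid.
Proof. by apply: tensor_yang_baxter; apply: braid_yang_baxter. Qed.

Lemma gen_exchange (a b : 'I_n) (alpha beta : 'I_m) :
  contract (@braid K q n) (fun b' a' => gen (a', alpha) * gen (b', beta)) b a =
  contract (@braid K q m) (fun alpha' beta' => gen (b, beta') * gen (a, alpha'))
    alpha beta.
Proof.
move: a b alpha beta.
apply/(exchange_relations (fun a alpha b beta => gen (a, alpha) * gen (b, beta))).
split=> a b alpha beta; [exact: zgen_row | exact: zgen_anti | exact: zgen_diag].
Qed.

(** The matrix of coefficients in the rule that dz_c z_d is the sum over e and d'
    of [mbraid c d e d'] times z_d' dz_e, applied to the column [u]. *)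
Definition slide1 (d : G) (u : G -> A) (c : G) : A :=
  contract mbraid (fun e d' => gen d' * u e) c d.

Fixpoint slide (x : aterm K G) (u : G -> A) : G -> A :=
  match x with
  | AGen d => slide1 d u
  | ACst k => fun c => k *: u c
  | AAdd x y => fun c => slide x u c + slide y u c
  | AMul x y => slide x (slide y u)
  end.

Lemma slideD x u v : slide x (fun c => u c + v c) = fun c => slide x u c + slide x v c.
Proof.
elim: x u v => [d|k|x IHx y IHy|x IHx y IHy] u v /=.
- apply/funext => c; rewrite /slide1 /contract -big_split; apply: eq_bigr => e _.
  by rewrite -big_split; apply: eq_bigr => f _; rewrite mulrDr scalerDr.
- by apply/funext => c; rewrite scalerDr.
- by apply/funext => c; rewrite IHx IHy addrACA.
- by rewrite IHy IHx.
Qed.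

Lemma slideZ x k u : slide x (fun c => k *: u c) = fun c => k *: slide x u c.
Proof.
elim: x u => [d|l|x IHx y IHy|x IHx y IHy] u /=.
- apply/funext => c; rewrite /slide1 /contract scaler_sumr; apply: eq_bigr => e _.
  rewrite scaler_sumr; apply: eq_bigr => f _.
  by rewrite -pscalerAr !scalerA mulrC.
- by apply/funext => c; rewrite !scalerA mulrC.
- by apply/funext => c; rewrite IHx IHy scalerDr.
- by rewrite IHy IHx.
Qed.

Lemma contract_mulr (I : finType) (S : I -> I -> I -> I -> K) (H : I -> I -> A) i j w :
  contract S (fun x y => H x y * w) i j = contract S H i j * w.
Proof.
rewrite /contract mulr_suml; apply: eq_bigr => x _.
by rewrite mulr_suml; apply: eq_bigr => y _; rewrite -pscalerAl.
Qed.

(** The operators [slide1] satisfy the exchange relation because the generators do: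
    the Yang-Baxter equation in the Latin indices brings the outer braiding next to
    the product of two generators, where the exchange relation turns it into a
    braiding of the Greek indices, which a second use of the equation moves out. *)
Lemma slide1_exchange (u : G -> A) (c : G) (a b : 'I_n) (alpha beta : 'I_m) :
  contract (@braid K q n)
    (fun b' a' => slide1 (a', alpha) (slide1 (b', beta) u) c) b a =
  contract (@braid K q m)
    (fun alpha' beta' => slide1 (b, beta') (slide1 (a, alpha') u) c) alpha beta.
Proof.
pose Rn := @braid K q n; pose Rm := @braid K q m.
have slide2E a1 alpha1 b1 beta1 : slide1 (a1, alpha1) (slide1 (b1, beta1) u) c =
    contract Rn (fun g a' => contract Rn (fun e b' =>
    contract Rm (fun g2 alpha' => contract Rm (fun e2 beta' =>
      gen (a', alpha') * gen (b', beta') * u (e, e2)) g2 beta1) c.2 alpha1) g b1)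
      c.1 a1.
  rewrite /slide1 contract_tensor /=; apply: eq_contract => g a'.
  rewrite [RHS]contractC; apply: eq_contract => g2 alpha'.
  rewrite contract_tensor /= /contract.
  rewrite mulr_sumr; apply: eq_bigr => e _; rewrite mulr_sumr; apply: eq_bigr => b' _.
  rewrite -pscalerAr; congr (_ *: _).
  rewrite mulr_sumr; apply: eq_bigr => e2 _; rewrite mulr_sumr.
  by apply: eq_bigr => beta' _; rewrite -pscalerAr mulrA.
pose F e b' a' := contract Rm (fun g2 alpha' => contract Rm (fun e2 beta' =>
  gen (a', alpha') * gen (b', beta') * u (e, e2)) g2 beta) c.2 alpha.
transitivity (contract Rn (fun b1 a1 => contract Rn (fun g a' =>
    contract Rn (fun e b' => F e b' a') g b1) c.1 a1) b a).
  by apply: eq_contract => b' a'; rewrite slide2E.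
rewrite -(contract_yang_baxter (@braid_yang_baxter K q n q0) F).
transitivity (contract Rn (fun g b1 => contract Rn (fun e a1 =>
    contract Rm (fun alpha1 beta1 => contract Rm (fun g2 alpha' =>
    contract Rm (fun e2 beta' => gen (b1, alpha') * gen (a1, beta') * u (e, e2))
      g2 alpha1) c.2 beta1) alpha beta) g a) c.1 b); last first.
  under [RHS]eq_contract => alpha1 beta1 do rewrite slide2E.
  rewrite -[RHS](contractC Rn Rm); apply: eq_contract => g b1.
  by rewrite -[RHS](contractC Rn Rm).
apply: eq_contract => g b1; apply: eq_contract => e a1.
rewrite -(contract_yang_baxter (@braid_yang_baxter K q m q0)
  (fun e2 beta' alpha' => gen (b1, alpha') * gen (a1, beta') * u (e, e2))).
rewrite (contractC Rn Rm); apply: eq_contract => g2 alpha1.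
rewrite (contractC Rn Rm); apply: eq_contract => e2 beta1.
by rewrite !contract_mulr gen_exchange.
Qed.

(** Hence words in the generators act through the quantum matrix algebra. *)
Lemma slide_aeq x y : aeq (@mat_rel K q m n) x y -> slide x = slide y.
Proof.
elim=> {x y} /=.
- move=> x y; have Rel u c := (exchange_relations (fun a alpha b beta =>
    slide1 (a, alpha) (slide1 (b, beta) u) c)).1 (slide1_exchange u c).
  case=> [a b alpha beta h | a b alpha beta h1 h2 | a b alpha beta h1 h2];
    apply/funext => u; apply/funext => c; have [Row Anti Diag] := Rel u c.
  + exact: Row.
  + exact: Anti.
  + exact: Diag.
- by [].
- by move=> x y _ ->.
- by move=> x y z _ -> _ ->.
- by move=> x x' y y' _ -> _ ->.
- by move=> x x' y y' _ -> _ ->.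
- by move=> x y z; apply/funext => u; apply/funext => c; rewrite addrA.
- by move=> x y; apply/funext => u; apply/funext => c; rewrite addrC.
- by move=> x; apply/funext => u; apply/funext => c; rewrite scale0r add0r.
- by move=> x; apply/funext => u; apply/funext => c; rewrite scaleN1r addNr scale0r.
- by [].
- by move=> x; apply/funext => u; apply/funext => c; rewrite scale1r.
- by [].
- by move=> x y z; apply/funext => u; rewrite slideD.
- by move=> c d; apply/funext => u; apply/funext => c'; rewrite scalerDl.
- by move=> c d; apply/funext => u; apply/funext => c'; rewrite scalerA.
- by move=> k x; apply/funext => u; rewrite slideZ.
Qed.

End Exchange.

(** * Freeness of the module of 1-forms and the partial derivatives *)

Section Forms.
Variables (K : numClosedFieldType) (q : K) (m n : nat).
Hypothesis q0 : q != 0.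
Local Notation G := ('I_n * 'I_m)%type.
Local Notation A := (qmat q m n).
Local Notation gen := (@gen K q m n).
Local Notation mbraid := (@mbraid K q m n).

Lemma qmat_ind_left (P : A -> Prop) :
  P 1 -> (forall f g, P f -> P g -> P (f + g)) -> (forall k f, P f -> P (k *: f)) ->
  (forall d f, P f -> P (gen d * f)) -> forall f, P f.
Proof.
move=> P1 PD PZ PM; apply: palgW => x; rewrite -[acl _ x]mulr1.
move: (1 : A) P1 => f; elim: x f => [[d1 d2]|k|x IHx y IHy|x IHx y IHy] f Pf.
- exact: (PM (d1, d2)).
- by rewrite acl_cst -pscalerAl mul1r; exact: PZ.
- by rewrite acl_add mulrDl; apply: PD; [exact: IHx | exact: IHy].
- by rewrite acl_mul -mulrA; apply/IHx/IHy.
Qed.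

Lemma qmat_ind_right (P : A -> Prop) :
  P 1 -> (forall f g, P f -> P g -> P (f + g)) -> (forall k f, P f -> P (k *: f)) ->
  (forall d f, P f -> P (f * gen d)) -> forall f, P f.
Proof.
move=> P1 PD PZ PM; apply: palgW => x; rewrite -[acl _ x]mul1r.
move: (1 : A) P1 => f; elim: x f => [[d1 d2]|k|x IHx y IHy|x IHx y IHy] f Pf.
- exact: (PM (d1, d2)).
- by rewrite acl_cst -pscalerAr mulr1; exact: PZ.
- by rewrite acl_add mulrDr; apply: PD; [exact: IHx | exact: IHy].
- by rewrite acl_mul mulrA; apply/IHy/IHx.
Qed.

Definition delta (e c : G) : A := (c == e)%:R.

(** The coefficients in the rule that dz_c f is the sum over e of
    [transit f c e] dz_e. *)
Definition transit (f : A) (c e : G) : A := slide (arepr f) (delta e) c.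

Lemma transit_acl x : transit (acl (@mat_rel K q m n) x) = fun c e => slide x (delta e) c.
Proof.
by apply/funext => c; apply/funext => e; rewrite /transit (slide_aeq q0 (repr_aeq _ x)).
Qed.

Lemma transit1 c e : transit 1 c e = (c == e)%:R.
Proof. by rewrite (transit_acl (ACst 1)) /= scale1r. Qed.

Lemma transitD f g c e : transit (f + g) c e = transit f c e + transit g c e.
Proof.
elim/palgW: f => f; elim/palgW: g => g.
by rewrite -acl_add !transit_acl.
Qed.

Lemma transitZ k f c e : transit (k *: f) c e = k *: transit f c e.
Proof. by elim/palgW: f => f; rewrite [k *: _]acl_scale !transit_acl. Qed.

Lemma transit_gen_mul d f c e :
  transit (gen d * f) c e = contract mbraid (fun e' d' => gen d' * transit f e' e) c d.
Proof.
elim/palgW: f => f; case: d => d1 d2.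
by rewrite [_ * _](esym (acl_mul _ (AGen (d1, d2)) f)) !transit_acl.
Qed.

Lemma transitM f g c e : transit (f * g) c e = \sum_i transit f c i * transit g i e.
Proof.
elim/qmat_ind_left: f c => [|f1 f2 IH1 IH2|k f IH|d f IH] c.
- rewrite mul1r (bigD1 c) //= transit1 eqxx mul1r big1 ?addr0 // => i /negPf ic.
  by rewrite transit1 eq_sym ic mul0r.
- rewrite mulrDl transitD IH1 IH2 -big_split; apply: eq_bigr => i _.
  by rewrite transitD mulrDl.
- rewrite -pscalerAl transitZ IH scaler_sumr; apply: eq_bigr => i _.
  by rewrite transitZ pscalerAl.
- rewrite -mulrA transit_gen_mul.
  under eq_contract => e' d' do (rewrite IH mulr_sumr;
    under eq_bigr => i _ do rewrite mulrA).
  rewrite contract_sum; apply: eq_bigr => i _.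
  by rewrite contract_mulr transit_gen_mul.
Qed.

Lemma transit_gen d c e :
  transit (gen d) c e = contract mbraid (fun e' d' => gen d' * (e' == e)%:R) c d.
Proof.
rewrite -[gen d]mulr1 transit_gen_mul; apply: eq_contract => e' d'.
by rewrite transit1.
Qed.

(** Coordinates of a 1-form in the basis dz_e of the left module; the right action
    is dictated by [transit].  That they respect the relations of the bimodule
    shows that the dz_e are linearly independent over the algebra, and so that the
    partial derivatives are determined by the differential. *)
Fixpoint coords (w : mterm K (A + A) G) : G -> A :=
  match w with
  | MGen c => fun e => (e == c)%:R
  | MZero => fun=> 0
  | MAdd v w => fun e => coords v e + coords w e
  | MScale k w => fun e => k *: coords w e
  | MAct (inl f) w => fun e => f * coords w e
  | MAct (inr f) w => fun e => \sum_c coords w c * transit f c e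
  end.

Lemma coords_sum (I : Type) (r : seq I) (F : I -> mterm K (A + A) G) e :
  coords (msum r F) e = \sum_(i <- r) coords (F i) e.
Proof. by elim: r => [|i r IHr] /=; rewrite ?big_nil // big_cons IHr. Qed.

(** The coefficients R of the relations z dz = R R dz z, with indices ordered as
    those of [braid]. *)
Definition inv_braid (k : nat) (a b c d : 'I_k) : K := Rcoef q b a d c.

Lemma contract_inv_braid (k : nat) (V : lmodType K) (F : 'I_k -> 'I_k -> V) c d :
  contract (@inv_braid k) F c d =
  (if c == d then q^-1 else 1) *: F c d + ((c < d)%N%:R * (q^-1 - q)) *: F d c.
Proof.
apply: contract_swap => e f.
rewrite /inv_braid /Rcoef.
have [->|ec] := eqVneq e c; have [->|fd] := eqVneq f d;
  have [?|cd] := eqVneq c d; subst; rewrite ?eqxx ?ltnn //=;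
  rewrite ?(eq_sym c f) ?(eq_sym d e) ?(negPf ec) ?(negPf fd) ?(negPf cd) /= .
all: rewrite ?andbF ?mulr0 ?mulr1 ?mul0r ?addr0 ?add0r ?mul1r //=.
  by rewrite eq_sym (negPf fd).
have [_|] := eqVneq f c; last by rewrite !andbF mulr0.
have [_|] := eqVneq e d; last by rewrite !andbF mulr0.
by rewrite !andbT mulr1; case: ltnP; rewrite ?mul1r ?mul0r.
Qed.

Lemma inv_braidK (k : nat) (V : lmodType K) (F : 'I_k -> 'I_k -> V) a b :
  contract (@inv_braid k) (fun a' b' => contract (@braid K q k) F a' b') a b = F a b.
Proof.
rewrite contract_inv_braid !contract_braid -!val_eqE /=.
have [ab|ba|/val_inj eab] := ltngtP a b; subst;
  rewrite ?mul0r ?mul1r ?scale0r ?scale1r ?addr0 ?scalerA ?mulVf ?scale1r //.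
by rewrite -addrA -scalerDl addrA subrK subrr scale0r addr0.
Qed.

Lemma coords_forms_rel_gen a b alpha beta e :
  \sum_(alpha' < m) \sum_(beta' < m) \sum_(a' < n) \sum_(b' < n)
    (Rcoef q beta alpha beta' alpha' * Rcoef q b a b' a') *:
       transit (gen (b', beta')) (a', alpha') e = gen (b, beta) * (e == (a, alpha))%:R.
Proof.
transitivity (contract (@inv_braid m) (fun alpha' beta' => contract (@inv_braid n)
    (fun a' b' => transit (gen (b', beta')) (a', alpha') e) a b) alpha beta).
  rewrite /contract; apply: eq_bigr => alpha' _; apply: eq_bigr => beta' _.
  rewrite scaler_sumr; apply: eq_bigr => a' _; rewrite scaler_sumr.
  by apply: eq_bigr => b' _; rewrite scalerA.
under eq_contract => alpha' beta' do (under eq_contract => a' b' do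
  rewrite transit_gen contract_tensor /=; rewrite inv_braidK).
by rewrite inv_braidK eq_sym.
Qed.

Lemma coords_meq v w : meq (@forms_rel K q m n) v w -> coords v = coords w.
Proof.
elim=> {v w} /=.
- move=> v w; case=> {v w}
    [x|f g x|f g x|k f x|x|f g x|f g x|k f x|f g x|a b alpha beta] /=;
    apply/funext => e.
  + by rewrite mul1r.
  + by rewrite mulrA.
  + by rewrite mulrDl.
  + by rewrite pscalerAl.
  + rewrite (bigD1 e) //= transit1 eqxx mulr1 big1 ?addr0 // => i /negPf ie.
    by rewrite transit1 ie mulr0.
  + under eq_bigr => c _ do rewrite transitM mulr_sumr.
    rewrite exchange_big /=; apply: eq_bigr => c _; rewrite mulr_suml.
    by apply: eq_bigr => i _; rewrite mulrA.
  + by rewrite -big_split; apply: eq_bigr => c _; rewrite transitD mulrDr.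
  + by rewrite scaler_sumr; apply: eq_bigr => c _; rewrite transitZ pscalerAr.
  + by rewrite mulr_sumr; apply: eq_bigr => c _; rewrite mulrA.
  + rewrite -coords_forms_rel_gen coords_sum big_enum /=; apply: eq_bigr => alpha' _.
    rewrite coords_sum big_enum /=; apply: eq_bigr => beta' _.
    rewrite coords_sum big_enum /=; apply: eq_bigr => a' _.
    rewrite coords_sum big_enum /=; apply: eq_bigr => b' _.
    congr (_ *: _); rewrite (bigD1 (a', alpha')) //= eqxx mul1r big1 ?addr0 //.
    by move=> c /negPf ca; rewrite ca mul0r.
- by [].
- by move=> x y _ ->.
- by move=> x y z _ -> _ ->.
- by move=> x x' y y' _ -> _ ->.
- by move=> k x x' _ ->.
- by move=> [f|f] x x' _ ->.
- by move=> x y z; apply/funext => e; rewrite addrA.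
- by move=> x y; apply/funext => e; rewrite addrC.
- by move=> x; apply/funext => e; rewrite add0r.
- by move=> x; apply/funext => e; rewrite scaleN1r addNr.
- by move=> k l x; apply/funext => e; rewrite scalerA.
- by move=> x; apply/funext => e; rewrite scale1r.
- by move=> k x y; apply/funext => e; rewrite scalerDr.
- by move=> k l x; apply/funext => e; rewrite scalerDl.
- move=> [f|f] x y; apply/funext => e; first by rewrite mulrDr.
  by rewrite -big_split; apply: eq_bigr => c _; rewrite mulrDl.
- move=> [f|f] k x; apply/funext => e; first by rewrite pscalerAr.
  by rewrite scaler_sumr; apply: eq_bigr => c _; rewrite pscalerAl.
Qed.

Definition coord (e : G) (w : forms q m n) : A := coords (mrepr w) e.

Lemma coord_mcl e x : coord e (mcl (@forms_rel K q m n) x) = coords x e.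
Proof. by rewrite /coord (coords_meq (repr_meq _ x)). Qed.

Lemma coordD e v w : coord e (v + w) = coord e v + coord e w.
Proof. by elim/pmodW: v => v; elim/pmodW: w => w; rewrite -mcl_add !coord_mcl. Qed.

Lemma coordZ e k w : coord e (k *: w) = k *: coord e w.
Proof. by elim/pmodW: w => w; rewrite -mcl_scale !coord_mcl. Qed.

Lemma coord_lact e f w : coord e (lact f w) = f * coord e w.
Proof. by elim/pmodW: w => w; rewrite /lact -mcl_act !coord_mcl. Qed.

Lemma coord_ract e f w : coord e (ract w f) = \sum_c coord c w * transit f c e.
Proof.
elim/pmodW: w => w; rewrite /ract -mcl_act coord_mcl.
by apply: eq_bigr => c _; rewrite coord_mcl.
Qed.

Lemma coord_dz e a alpha : coord e (dz q a alpha) = (e == (a, alpha))%:R.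
Proof. exact: coord_mcl. Qed.

Lemma coord_sum e (I : Type) (r : seq I) (F : I -> forms q m n) :
  coord e (\sum_(i <- r) F i) = \sum_(i <- r) coord e (F i).
Proof.
elim: r => [|i r IHr]; rewrite ?big_nil ?big_cons ?coordD ?IHr //.
exact: (coord_mcl e MZero).
Qed.

Section Partial.
Variables (d : {linear A -> forms q m n}) (partial : 'I_n -> 'I_m -> A -> A).
Hypotheses (hd : is_differential d) (hpartial : is_partial d partial).

Definition dpart (g : G) (f : A) : A := partial g.1 g.2 f.

Lemma dpartE g f : dpart g f = coord g (d f).
Proof.
case: g => a alpha; rewrite hpartial coord_sum.
rewrite (bigD1 a) //= [X in _ + X]big1 => [|b /negPf ba].
  rewrite addr0 coord_sum (bigD1 alpha) //= [X in _ + X]big1 => [|beta /negPf ba].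
    by rewrite addr0 coord_lact coord_dz eqxx mulr1.
  by rewrite coord_lact coord_dz xpair_eqE eqxx eq_sym ba mulr0.
rewrite coord_sum big1 // => beta _.
by rewrite coord_lact coord_dz xpair_eqE eq_sym ba mulr0.
Qed.

Lemma dpartD g f1 f2 : dpart g (f1 + f2) = dpart g f1 + dpart g f2.
Proof. by rewrite !dpartE linearD coordD. Qed.

Lemma dpartZ g k f : dpart g (k *: f) = k *: dpart g f.
Proof. by rewrite !dpartE linearZ coordZ. Qed.

Lemma dpart1 g : dpart g 1 = 0.
Proof.
have := hd.2 1 1; rewrite mulr1 ract1 lact1 => /eqP.
rewrite -subr_eq0 opprD addrA subrr sub0r oppr_eq0 => /eqP d1.
by rewrite dpartE d1; exact: (coord_mcl g MZero).
Qed.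

(** The Leibniz rule for a left factor [gen c], since d(z_c f) = dz_c f + z_c df. *)
Lemma dpart_gen_mul g c f : dpart g (gen c * f) = transit f c g + gen c * dpart g f.
Proof.
rewrite !dpartE hd.2 coordD coord_lact; congr (_ + _).
rewrite coord_ract /gen hd.1 (bigD1 c) //= big1 => [|e /negPf ec].
  by rewrite addr0 coord_dz -surjective_pairing eqxx mul1r.
by rewrite coord_dz -surjective_pairing ec mul0r.
Qed.

End Partial.
End Forms.

(** * Positive definite Hermitian forms *)

Section Dot.
Variables (K : numClosedFieldType) (U : lmodType K) (form : {dot U for Num.conj}).

Lemma dotDl u v w : form (u + v) w = form u w + form v w.
Proof. exact: linearDl. Qed.
Lemma dotDr u v w : form u (v + w) = form u v + form u w.
Proof. exact: linearDr. Qed.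
Lemma dotZl k u v : form (k *: u) v = k * form u v.
Proof. exact: linearZl_LR. Qed.
Lemma dotZr k u v : form u (k *: v) = Num.conj k * form u v.
Proof. exact: linearZr_LR. Qed.
Lemma dot0l u : form 0 u = 0.
Proof. exact: linear0l. Qed.
Lemma dot0r u : form u 0 = 0.
Proof. exact: linear0r. Qed.
Lemma dot_eq0C u v : form u v = 0 -> form v u = 0.
Proof. by move=> uv0; apply/eqP; rewrite herm_eq0C; exact/eqP. Qed.
Lemma dot_suml (I : Type) (r : seq I) (F : I -> U) v :
  form (\sum_(i <- r) F i) v = \sum_(i <- r) form (F i) v.
Proof. by elim: r => [|i r IHr]; rewrite ?big_nil ?dot0l // !big_cons dotDl IHr. Qed.
End Dot.

(** * Annihilation operators and partial derivatives *)

Section Fock.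
Variables (K : numClosedFieldType) (q : K) (m n : nat).
Hypothesis q0 : q != 0.
Local Notation G := ('I_n * 'I_m)%type.
Local Notation A := (qmat q m n).
Local Notation gen := (@gen K q m n).
Local Notation mbraid := (@mbraid K q m n).

Definition fvec (f : A) : fock q m n := act (qmat_pol f) (vac q m n).
Definition annih (g : G) (v : fock q m n) : fock q m n := act (star (qmat_pol (gen g))) v.

Lemma fvecD f g : fvec (f + g) = fvec f + fvec g.
Proof. by rewrite /fvec qmat_polD actDl. Qed.
Lemma fvecZ k f : fvec (k *: f) = k *: fvec f.
Proof. by rewrite /fvec qmat_polZ actZl. Qed.
Lemma fvec0 : fvec 0 = 0.
Proof. by have := fvecZ 0 0; rewrite !scale0r. Qed.
Lemma fvec_sum (I : Type) (r : seq I) (F : I -> A) :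
  fvec (\sum_(i <- r) F i) = \sum_(i <- r) fvec (F i).
Proof. by elim: r => [|i r IHr]; rewrite ?big_nil ?fvec0 // !big_cons fvecD IHr. Qed.
Lemma fvecM f g : fvec (f * g) = act (qmat_pol f) (fvec g).
Proof. by rewrite /fvec qmat_polM actM. Qed.

Lemma actDr (f : qpol q m n) (v w : fock q m n) : act f (v + w) = act f v + act f w.
Proof. exact: mactD. Qed.
Lemma actZr (f : qpol q m n) k (v : fock q m n) : act f (k *: v) = k *: act f v.
Proof. exact: mactZ. Qed.
Lemma act0r (f : qpol q m n) : act f 0 = 0 :> fock q m n.
Proof. by have := actZr f 0 0; rewrite !scale0r. Qed.
Lemma act_sumr f (I : Type) (r : seq I) (F : I -> fock q m n) :
  act f (\sum_(i <- r) F i) = \sum_(i <- r) act f (F i).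
Proof. by elim: r => [|i r IHr]; rewrite ?big_nil ?act0r // !big_cons actDr IHr. Qed.
Lemma act_suml (I : Type) (r : seq I) (F : I -> qpol q m n) v :
  act (\sum_(i <- r) F i) v = \sum_(i <- r) act (F i) v.
Proof.
elim: r => [|i r IHr]; last by rewrite !big_cons actDl IHr.
by have := actZl 0 0 v; rewrite !big_nil !scale0r.
Qed.

Lemma annihD g v w : annih g (v + w) = annih g v + annih g w.
Proof. exact: actDr. Qed.
Lemma annihZ g k v : annih g (k *: v) = k *: annih g v.
Proof. exact: actZr. Qed.
Lemma annih_sum g (I : Type) (r : seq I) (F : I -> fock q m n) :
  annih g (\sum_(i <- r) F i) = \sum_(i <- r) annih g (F i).
Proof. exact: act_sumr. Qed.
Lemma annih1 g : annih g (fvec 1) = 0.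
Proof. by rewrite /annih /fvec qmat_pol1 act1 act_star_vac. Qed.
Lemma annih0 g : annih g 0 = 0.
Proof. exact: act0r. Qed.

Lemma annih_gen_mul b a f :
  annih b (fvec (gen a * f)) =
  \sum_a' \sum_b' mbraid a b' a' b *: act (qmat_pol (gen a')) (annih b' (fvec f))
  + (a == b)%:R *: fvec f.
Proof.
rewrite fvecM /annih -actM star_zgen_mul actDl actZl act1; congr (_ + _); last first.
  by rewrite -natrM mulnb -xpair_eqE -!surjective_pairing eq_sym.
rewrite act_suml.
pose H a' b' := mbraid a b' a' b *: act (qmat_pol (gen a')) (annih b' (fvec f)).
transitivity (\sum_a1 \sum_a2 \sum_b1 \sum_b2 H (a1, a2) (b1, b2)); last first.
  rewrite pair_bigA; apply: eq_bigr => -[a1 a2] _.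
  by rewrite pair_bigA; apply: eq_bigr => -[b1 b2] _.
apply: eq_bigr => a1 _; rewrite act_suml [RHS]exchange_big; apply: eq_bigr => b1 _.
rewrite act_suml; apply: eq_bigr => a2 _; rewrite act_suml; apply: eq_bigr => b2 _.
by rewrite actZl actM.
Qed.

Variables (d : {linear A -> forms q m n}) (partial : 'I_n -> 'I_m -> A -> A).
Hypotheses (hd : is_differential d) (hpartial : is_partial d partial).
Local Notation dpart := (dpart partial).

(** An annihilation operator, carried by the map from [f] to [fvec f], is a twisted
    derivation with respect to left multiplication, while a partial derivative is
    one with respect to right multiplication, and the two commute.  The family [L]
    is the image of [f] under the annihilation operators.  It is only asserted to
    exist for each [f], which avoids proving that it depends only on [f].
    The second clause is the commutation; moving the derivative past a left
    factor produces [transit], so the third clause, where the annihilation operator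
    meets [transit], has to be carried through the induction with it. *)
Lemma left_derivatives (f : A) : exists L : G -> A,
  [/\ forall b, annih b (fvec f) = fvec (L b),
      forall a b, annih b (fvec (dpart a f)) = fvec (dpart a (L b))
    & forall a b c, annih b (fvec (transit f c a)) =
        \sum_c' \sum_y mbraid c y c' b *: fvec (transit (L y) c' a)].
Proof.
elim/qmat_ind_left: f =>
  [|f g [Lf [f1 f2 f3]] [Lg [g1 g2 g3]]|k f [L [L1 L2 L3]]|x f [L [L1 L2 L3]]].
- have dp0 a : dpart a 0 = 0 by have := dpartZ q0 hpartial a 0 0; rewrite !scale0r.
  have tr0 c a : transit (0 : A) c a = 0 by have := transitZ q0 0 0 c a; rewrite !scale0r.
  exists (fun=> 0); split=> [b|a b|a b c].
  + by rewrite annih1 fvec0.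
  + by rewrite (dpart1 q0 hd hpartial) dp0 fvec0 annih0.
  + rewrite transit1 // big1 => [|? _]; last first.
      by apply: big1 => ? _; rewrite tr0 fvec0 scaler0.
    by case: eqP => _; rewrite ?annih1 // fvec0 annih0.
- exists (fun b => Lf b + Lg b); split=> [b|a b|a b c].
  + by rewrite !fvecD annihD f1 g1.
  + by rewrite !(dpartD q0 hpartial) !fvecD annihD f2 g2.
  + rewrite (transitD q0) fvecD annihD f3 g3 -big_split; apply: eq_bigr => c' _.
    rewrite -big_split; apply: eq_bigr => y _.
    by rewrite (transitD q0) fvecD scalerDr.
- exists (fun b => k *: L b); split=> [b|a b|a b c].
  + by rewrite !fvecZ annihZ L1.
  + by rewrite !(dpartZ q0 hpartial) !fvecZ annihZ L2.
  + rewrite (transitZ q0) fvecZ annihZ L3 scaler_sumr; apply: eq_bigr => c' _.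
    rewrite scaler_sumr; apply: eq_bigr => y _.
    by rewrite (transitZ q0) fvecZ !scalerA mulrC.
exists (fun b => \sum_a' \sum_b' mbraid x b' a' b *: (gen a' * L b') + (x == b)%:R *: f).
have dp_sum a (F : G -> A) : dpart a (\sum_i F i) = \sum_i dpart a (F i).
  apply: (big_morph _ (dpartD q0 hpartial a)).
  by have := dpartZ q0 hpartial a 0 0; rewrite !scale0r.
have tr_sum c a (F : G -> A) : transit (\sum_i F i) c a = \sum_i transit (F i) c a.
  apply: (big_morph (fun f => transit f c a) (fun f g => transitD q0 f g c a)).
  by have := transitZ q0 0 0 c a; rewrite !scale0r.
split=> [b|a b|a b c].
- rewrite annih_gen_mul fvecD fvecZ; congr (_ + _).
  rewrite fvec_sum; apply: eq_bigr => a' _; rewrite fvec_sum; apply: eq_bigr => b' _.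
  by rewrite fvecZ fvecM L1.
- rewrite (dpart_gen_mul q0 hd hpartial) fvecD annihD annih_gen_mul L3.
  rewrite (dpartD q0 hpartial) (dpartZ q0 hpartial) fvecD fvecZ addrA.
  congr (_ + _); rewrite -big_split dp_sum fvec_sum; apply: eq_bigr => a' _.
  rewrite -big_split dp_sum fvec_sum; apply: eq_bigr => b' _ /=.
  rewrite (dpartZ q0 hpartial) (dpart_gen_mul q0 hd hpartial) fvecZ fvecD scalerDr.
  by rewrite L2 -fvecM.
have contractE (F : G -> G -> A) i j :
    fvec (contract mbraid F i j) = \sum_e \sum_f mbraid i j e f *: fvec (F e f).
  rewrite fvec_sum; apply: eq_bigr => e _; rewrite fvec_sum.
  by apply: eq_bigr => g _; rewrite fvecZ.
(* Both sides of the third clause are expanded into a term where the annihilation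
   operator passes the new factor and a term where it cancels it; the former are
   equal by the Yang-Baxter equation, the latter by inspection. *)
pose X i g y := fvec (gen g * transit (L y) i a).
transitivity (\sum_e \sum_f mbraid c x e f *: (\sum_g \sum_h mbraid f h g b *:
    (\sum_i \sum_y mbraid e y i h *: X i g y)) +
    \sum_e mbraid c x e b *: fvec (transit f e a)).
  rewrite transit_gen_mul // contractE annih_sum -big_split; apply: eq_bigr => e _ /=.
  have -> : mbraid c x e b *: fvec (transit f e a) =
      \sum_y mbraid c x e y *: ((y == b)%:R *: fvec (transit f e a)).
    rewrite (bigD1 b) //= eqxx scale1r big1 ?addr0 // => y /negPf ->.
    by rewrite scale0r scaler0.
  rewrite annih_sum -big_split; apply: eq_bigr => y _ /=.
  rewrite annihZ annih_gen_mul -scalerDr; congr (_ *: (_ + _)).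
  apply: eq_bigr => g _; apply: eq_bigr => h _; congr (_ *: _).
  rewrite L3 act_sumr; apply: eq_bigr => i _; rewrite act_sumr.
  by apply: eq_bigr => z _; rewrite actZr -fvecM.
rewrite yang_baxter_sum; last exact: mbraid_yang_baxter.
rewrite -big_split; apply: eq_bigr => e _ /=.
have -> : mbraid c x e b *: fvec (transit f e a) =
    \sum_y mbraid c y e b *: ((x == y)%:R *: fvec (transit f e a)).
  rewrite (bigD1 x) //= eqxx scale1r big1 ?addr0 // => y /negPf yx.
  by rewrite eq_sym yx scale0r scaler0.
rewrite -big_split; apply: eq_bigr => y _ /=.
rewrite -scalerDr (transitD q0) (transitZ q0) fvecD fvecZ; congr (_ *: (_ + _)).
rewrite tr_sum fvec_sum; apply: eq_bigr => g _.
rewrite tr_sum fvec_sum; apply: eq_bigr => h _.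
by rewrite (transitZ q0) fvecZ transit_gen_mul // contractE.
Qed.

Variable formH : {dot fock q m n for Num.conj}.
Hypothesis hformH : is_fock_product formH.

Lemma starK (f : qpol q m n) : star (star f) = f.
Proof. exact: pstarK. Qed.

Lemma form_annih b v w : formH (annih b v) w = formH v (act (qmat_pol (gen b)) w).
Proof. by rewrite hformH.2 starK. Qed.

Lemma form_gen b v w : formH (act (qmat_pol (gen b)) v) w = formH v (annih b w).
Proof. exact: hformH.2. Qed.

Lemma form_gen_vac b f : formH (fvec (gen b * f)) (fvec 1) = 0.
Proof. by rewrite fvecM form_gen annih1 dot0r. Qed.

(** Pairing with the vacuum kills every left multiple of a generator, so both
    sides only see the linear part of [P], where the derivative and the annihilation
    operator agree. *)
Lemma adjoint_dpart1 a P :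
  formH (fvec (dpart a P)) (fvec 1) = formH (fvec P) (fvec (gen a)).
Proof.
have -> : gen a = gen a * 1 by rewrite mulr1.
rewrite fvecM -form_annih.
elim/qmat_ind_left: P => [|f g IHf IHg|k f IH|x f _].
- by rewrite (dpart1 q0 hd hpartial) annih1 fvec0.
- by rewrite (dpartD q0 hpartial) !fvecD annihD !dotDl IHf IHg.
- by rewrite (dpartZ q0 hpartial) !fvecZ annihZ !dotZl IH.
rewrite (dpart_gen_mul q0 hd hpartial) fvecD dotDl form_gen_vac addr0.
rewrite annih_gen_mul dotDl dot_suml big1 ?add0r => [|a' _]; last first.
  rewrite dot_suml big1 // => b' _.
  by rewrite dotZl form_gen annih1 dot0r mulr0.
elim/qmat_ind_left: f x => [|f g IHf IHg|k f IH|y f _] x.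
- by rewrite transit1 //; case: eqP => _; rewrite ?scale1r // fvec0 scale0r.
- by rewrite (transitD q0) !fvecD scalerDr !dotDl IHf IHg.
- by rewrite (transitZ q0) !fvecZ scalerA mulrC -scalerA !(dotZl _ k) IH.
rewrite dotZl form_gen_vac mulr0 transit_gen_mul // /contract fvec_sum.
rewrite dot_suml big1 // => e _; rewrite fvec_sum dot_suml big1 // => g _.
by rewrite fvecZ dotZl form_gen_vac mulr0.
Qed.

(** A left factor of [Q] is moved across the form as an annihilation operator,
    which commutes with the derivative; this reduces the claim to [Q = 1]. *)
Lemma adjoint_dpart a P Q :
  formH (fvec (dpart a P)) (fvec Q) = formH (fvec P) (fvec (Q * gen a)).
Proof.
elim/qmat_ind_left: Q P => [|f g IHf IHg|k f IH|b f IH] P.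
- by rewrite mul1r adjoint_dpart1.
- by rewrite mulrDl !fvecD !dotDr IHf IHg.
- by rewrite -pscalerAl !fvecZ !dotZr IH.
have [L [L1 L2 _]] := left_derivatives P.
by rewrite -mulrA !(fvecM (gen b)) -!form_annih L2 IH L1.
Qed.

(** Stripping right factors off [Q] by adjointness reduces both forms to their
    values against 1, which vanish on right multiples of generators since
    derivatives kill 1. *)
Lemma form_unique (formF : {dot A for Num.conj}) : is_F_product partial formF ->
  forall P Q, formH (fvec P) (fvec Q) = formF P Q.
Proof.
move=> [F1 FA] P Q.
elim/qmat_ind_right: Q P => [|f g IHf IHg|k f IH|b f IH] P; last first.
- by rewrite -adjoint_dpart IH /gen -FA.
- by rewrite !fvecZ !dotZr IH.
- by rewrite !fvecD !dotDr IHf IHg.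
elim/qmat_ind_right: P => [|f g IHf IHg|k f IH|b f _].
- by rewrite F1 /fvec qmat_pol1 act1 hformH.1.
- by rewrite !fvecD !dotDl IHf IHg.
- by rewrite !fvecZ !dotZl IH.
rewrite (dot_eq0C (u := fvec 1)); last first.
  by rewrite -adjoint_dpart (dpart1 q0 hd hpartial) fvec0 dot0l.
symmetry; apply: dot_eq0C.
by rewrite /gen -FA [partial _ _ 1](dpart1 q0 hd hpartial b) dot0l.
Qed.
End Fock.

(** * The two inner products *)

Unset Implicit Arguments.
Local Open Scope complex_scope.

Theorem theorem2p3 (R : realType) (q : R) (m n : nat)
  (hq : 0 < q < 1)
  (d : {linear qmat (q%:C) m n -> forms (q%:C) m n})
  (hd : is_differential d)
  (partial : 'I_n -> 'I_m -> qmat (q%:C) m n -> qmat (q%:C) m n)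
  (hpartial : is_partial d partial)
  (formH : {dot fock (q%:C) m n for Num.conj})
  (hformH : is_fock_product formH) :
  (forall formF : {dot qmat (q%:C) m n for Num.conj},
     is_F_product partial formF ->
     forall P Q : qmat (q%:C) m n, transport formH P Q = formF P Q) /\
  (forall (P Q : qmat (q%:C) m n) (a : 'I_n) (alpha : 'I_m),
     transport formH (partial a alpha P) Q =
     transport formH P (Q * zgen (q%:C) a alpha)).
Proof.
have q0 : (q%:C) != 0 :> complex R.
  by rewrite eq_complex /= eqxx andbT; case/andP: hq => /lt0r_neq0.
split=> [formF hF P Q | P Q a alpha].
  exact: (form_unique q0 hd hpartial hformH hF).
exact: (adjoint_dpart q0 hd hpartial hformH (a, alpha)).
Qed.
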